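(* Let $m,n\in\mathbb{N}$ be such that $n\leq m$ and let $A$ be an invertible bounded operator on a complex Hilbert space such that $(A^* )^sA^s=(A^*A)^s$ for all $s\in\{m,\,n+m\}$ and $(A^* )^nA^n\leq(A^*A)^n$. Then $$|A^{p+m}|^{\frac{2m}{m+p}}\;\geq\;\Big((A^* )^m\,|A^p|^{\frac{2n}{p}}\,A^m\Big)^{\frac{m}{m+n}}\;\geq\;|A^m|^2$$ for every $p$ of the form $p=n+im$, where $i$ is a nonnegative integer.
   Context: $\mathbb{N}$ denotes the set of positive integers. For a bounded operator $T$, $|T|:=(T^*T)^{1/2}$. Real powers of positive operators are taken via the functional calculus, and $\leq$ is the usual order on bounded selfadjoint operators. Invertible means having a bounded everywhere defined inverse. *)

(* Defs.v *)
From HB Require Import structures.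
From mathcomp Require Import all_boot all_order all_algebra.
From mathcomp Require Import complex.
From mathcomp Require Import all_classical all_reals all_analysis.

Set Implicit Arguments.
Unset Strict Implicit.
Unset Printing Implicit Defensive.

Import Order.TTheory GRing.Theory Num.Theory.
Import numFieldNormedType.Exports.

Local Open Scope classical_set_scope.
Local Open Scope ring_scope.
Local Open Scope complex_scope.

(* The inner product is linear in its first argument, as in sesquilinear.v.
   Norms of vectors are nonnegative elements of R[i]. *)
HB.mixin Record CompleteNormedModule_isHilbert (R : realType) H
    & CompleteNormedModule R[i] H := {
  inner : {dot H for (@Num.conj R[i])} ;
  inner_normE : forall x : H, inner x x = `|x| ^+ 2
}.

#[short(type="hilbertType")]
HB.structure Definition Hilbert (R : realType) :=
  {H of CompleteNormedModule R[i] H & CompleteNormedModule_isHilbert R H}.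

Section Operators.
Context {R : realType} {H : hilbertType R}.
Implicit Types S T : H -> H.

Definition bounded_op T : Prop :=
  linear T /\ exists M : R, forall x, `|T x| <= M%:C * `|x|.

Definition invertible_op T : Prop :=
  exists2 S, bounded_op S & cancel T S /\ cancel S T.

(* For bounded T, the vector adj T y exists by the Riesz representation
   theorem; it is always unique when it exists. *)
Definition adj T : H -> H :=
  fun y => xget 0 [set z | forall x, inner (T x) y = inner x z].

Definition selfadjoint_op T : Prop := bounded_op T /\ adj T = T.

Definition op_le S T : Prop :=
  [/\ selfadjoint_op S, selfadjoint_op T &
      forall x, inner (S x) x <= inner (T x) x].

Definition spectrum T : set R[i] :=
  [set l | ~ invertible_op (fun x => T x - l *: x)].

Definition op_horner (q : {poly R}) T : H -> H :=
  fun x => \sum_(i < size q) (q`_i)%:C *: iter i T x.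

(* convergence in operator norm *)
Definition op_cvg (U : nat -> H -> H) S : Prop :=
  forall e : R, 0 < e ->
    \forall k \near \oo, forall x, `|U k x - S x| <= e%:C * `|x|.

(* Continuous functional calculus: for selfadjoint T (whose spectrum is real)
   and f continuous on the spectrum, f(T) is the operator-norm limit of q_k(T)
   for real polynomials q_k converging to f uniformly on the spectrum. *)
Definition fun_calc T (f : R -> R) : H -> H :=
  xget (fun=> 0) [set S | exists q : nat -> {poly R},
    {uniform [set t : R | spectrum T t%:C],
       (fun k => horner (q k)) @ \oo --> f} /\
    op_cvg (fun k => op_horner (q k) T) S].

Definition op_powR T (r : R) : H -> H := fun_calc T (fun t => t `^ r).

Definition op_abs T : H -> H := op_powR (adj T \o T) 2^-1.

End Operators.

(* Main.v *)
(* Write T_k = (A^* )^k A^k, B = A^* A and G = A^m. Since A is invertible all these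
   operators are positive definite. Put E = T_p^(1/p), so that T_(p+m) = G^* E^p G,
   and F(j) = (G^* E^j G)^(m/(m+j)); the claim reads F(p) >= F(n) >= T_m.
   - F(n) >= T_m holds once T_p^(n/p) >= T_n, because then, by Loewner-Heinz,
     F(n) >= T_(n+m)^(m/(m+n)) = B^m = T_m.
   - F(k) >= G^* G implies F(k+1) >= F(k): with K = E^(k/2) G and Y = K K^*, the
     hypothesis says Y^(k/(m+k)) <= E^k, hence Y^(1/(m+k)) <= E, and therefore
     G^* E^(k+1) G = K^* E K >= K^* Y^(1/(m+k)) K = (K^* K)^((m+k+1)/(m+k)).
   - T_p^(n/p) >= T_n passes from p to p + m, by raising T_(p+m)^(m/(p+m)) >= B^m to
     the power n/m <= 1 and using B^n >= T_n. *)
Require Import Defs.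
From mathcomp Require Import all_boot all_order all_algebra.
From mathcomp Require Import complex.
From mathcomp Require Import all_classical all_reals all_analysis.
From mathcomp Require Import ring lra.

Set Implicit Arguments.
Unset Strict Implicit.
Unset Printing Implicit Defensive.

Import Order.TTheory GRing.Theory Num.Theory.
Import numFieldNormedType.Exports.

Local Open Scope classical_set_scope.
Local Open Scope ring_scope.
Local Open Scope complex_scope.

(** * Bernstein polynomials *)

(** Loewner-Heinz is needed for rational exponents in [0, 1] only, which allows an elementary proof.
    Let l_j be the least constant with X^j <= l_j Y^j. Monotonicity of the square root gives
    l_(j+1)^2 <= l_j l_(j+2), so l_0 <= 1 and l_k <= 1 force l_n <= 1 in between. In the step for F,
    the claim Y^(k/(m+k)) <= E^k comes from (K^* K)^(1-r) = K^* Y^(-r) K with r = k/(m+k): the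
    hypothesis becomes G^* G <= K^* Y^(-r) K, cancelling K leaves E^(-k) <= Y^(-r), and inversion
    reverses the order. Powers are defined by choosing some limit of polynomials in the operator, so
    that limit must be shown to exist and to be unique. Existence rests on polynomial approximation
    of t^r, uniqueness on bounding the norm of q(T) by the supremum of |q| on the spectrum.
    Invertibility of A keeps every operator that is raised to a power above a positive multiple of
    the identity, and away from 0 all real powers are Lipschitz. *)

Section Bernstein.
Context {R : realType}.
Implicit Types (g : nat -> R) (x a b c e : R).

(* Mean of [g] at a binomial variable with parameters n and x, computed by
   conditioning on the first trial. *)
Fixpoint binom_mean (A : pzRingType) (x : A) n (g : nat -> A) : A :=
  if n is n'.+1 then
    binom_mean x n' (fun k => x * g k.+1 + (1 - x) * g k)
  else g 0%N.

(** Taking the mean in the ring of polynomials, with parameter ['X], makes it a polynomial; this is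
    why [binom_mean] is defined over any ring. *)
Definition bernstein n g : {poly R} := binom_mean 'X n (fun k => (g k)%:P).

Lemma horner_binom_mean x n (G : nat -> {poly R}) :
  (binom_mean 'X n G).[x] = binom_mean x n (fun k => (G k).[x]).
Proof.
elim: n G => //= n IH G; rewrite IH; congr (binom_mean x n _).
by apply/funext => k; rewrite !hornerE.
Qed.

Lemma horner_bernstein x n g : (bernstein n g).[x] = binom_mean x n g.
Proof.
rewrite horner_binom_mean; congr (binom_mean x n _).
by apply/funext => k; rewrite hornerC.
Qed.

Lemma binom_mean_le x n g h : 0 <= x <= 1 -> (forall k, (k <= n)%N -> g k <= h k) ->
  binom_mean x n g <= binom_mean x n h.
Proof.
move=> /andP[x0 x1]; elim: n g h => /= [|n IH] g h gh; first exact: gh.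
apply: IH => k kn; rewrite lerD// ler_wpM2l ?subr_ge0//; apply: gh => //.
exact: leqW.
Qed.

(** Conditioning on the first trial sends quadratics in k to quadratics in k, with new coefficients,
    so all three vary in the induction. The formula encodes the mean n x and the variance n x (1 -
    x). *)
Lemma binom_mean_quad x n a b c :
  binom_mean x n (fun k => a * k%:R ^+ 2 + b * k%:R + c) =
  a * (n%:R ^+ 2 * x ^+ 2 + n%:R * x * (1 - x)) + b * n%:R * x + c.
Proof.
elim: n a b c => [|n IH] a b c /=; first by ring.
rewrite -[RHS](_ : a * (n%:R ^+ 2 * x ^+ 2 + n%:R * x * (1 - x)) +
  (b + 2 * a * x) * n%:R * x + (c + a * x + b * x) = _); last first.
  by rewrite -natr1; ring.
rewrite -IH; congr (binom_mean x n _); apply/funext => k.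
by rewrite -natr1; ring.
Qed.

Lemma binom_mean_quad_eq x n g a b c :
  (forall k, (k <= n)%N -> g k = a * k%:R ^+ 2 + b * k%:R + c) -> 0 <= x <= 1 ->
  binom_mean x n g =
  a * (n%:R ^+ 2 * x ^+ 2 + n%:R * x * (1 - x)) + b * n%:R * x + c.
Proof.
move=> gE x01; rewrite -binom_mean_quad; apply/eqP.
by rewrite eq_le !binom_mean_le// => k kn; rewrite gE.
Qed.

(** Since |u| <= e + u^2 / e, the deviation |k/n - x| is dominated by a quadratic in k, whose mean
    is known; the variance x (1 - x) / n of k/n is then bounded by 1/n. The parameter e is left
    free, to be balanced against n. *)
Lemma bernstein_lipschitz (f : R -> R) (L : R) n x e : 0 < e -> 0 <= L ->
  (forall s t, 0 <= s <= 1 -> 0 <= t <= 1 -> `|f s - f t| <= L * `|s - t|) ->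
  0 <= x <= 1 ->
  `|(bernstein n.+1 (fun k => f (k%:R / n.+1%:R))).[x] - f x| <=
    L * (e + (e * n.+1%:R)^-1).
Proof.
move=> e0 L0 fL x01; have /andP[x0 x1] := x01.
have n0 : 0 < n.+1%:R :> R by rewrite ltr0n.
have bnd k : (k <= n.+1)%N ->
    `|f (k%:R / n.+1%:R) - f x| <= L * (e + e^-1 * (k%:R / n.+1%:R - x) ^+ 2).
  move=> kn; apply: le_trans (fL _ _ _ x01) _.
    by rewrite divr_ge0//= ler_pdivrMr// mul1r ler_nat.
  rewrite ler_wpM2l//; set u := k%:R / _ - x.
  have : 0 <= e^-1 * ((e - `|u|) ^+ 2 + e * `|u|).
    by rewrite mulr_ge0 ?invr_ge0 ?addr_ge0 ?sqr_ge0 ?mulr_ge0 // ltW.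
  rewrite sqrrB real_normK ?num_real//.
  rewrite (_ : e^-1 * _ = e + e^-1 * u ^+ 2 - `|u|) ?subr_ge0 //.
  by field; rewrite gt_eqF.
have val : forall s c : R,
    binom_mean x n.+1 (fun k => s * (L * (e + e^-1 * (k%:R / n.+1%:R - x) ^+ 2)) + c) =
    s * (L * (e + (e * n.+1%:R)^-1 * (x * (1 - x)))) + c.
  move=> s c.
  rewrite (@binom_mean_quad_eq _ _ _ (s * L / e / n.+1%:R ^+ 2)
     (- 2 * s * L / e / n.+1%:R * x) (s * L * (e + e^-1 * x ^+ 2) + c)) //.
    by field; rewrite gt_eqF//= gt_eqF.
  by move=> k _; field; rewrite gt_eqF//= gt_eqF.
have xx : L * (e + (e * n.+1%:R)^-1 * (x * (1 - x))) <= L * (e + (e * n.+1%:R)^-1).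
  rewrite ler_wpM2l// lerD2l -[leRHS]mulr1 ler_wpM2l ?invr_ge0 ?mulr_ge0 ?ltW//.
  have := sqr_ge0 x; nra.
(* The values of f at the nodes lie between [B (- 1)] and [B 1], whose means are given by [val]. *)
pose B (s : R) k := s * (L * (e + e^-1 * (k%:R / n.+1%:R - x) ^+ 2)) + f x.
rewrite horner_bernstein ler_norml; apply/andP; split.
- rewrite lerBrDr; apply: (@le_trans _ _ (binom_mean x n.+1 (B (- 1)))).
    by rewrite /B val mulN1r lerD2r lerN2.
  apply: binom_mean_le => // k /bnd; rewrite /B ler_norml mulN1r.
  by move=> /andP[+ _]; rewrite lerBrDr.
- rewrite lerBlDr; apply: (@le_trans _ _ (binom_mean x n.+1 (B 1))).
    apply: binom_mean_le => // k /bnd; rewrite /B ler_norml mul1r.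
    by move=> /andP[_]; rewrite lerBlDr.
  by rewrite /B val mul1r lerD2r.
Qed.

Lemma poly_approx (f : R -> R) (a b L e : R) : a < b -> 0 < e ->
  (forall s t, a <= s <= b -> a <= t <= b -> `|f s - f t| <= L * `|s - t|) ->
  exists q : {poly R}, forall t, a <= t <= b -> `|q.[t] - f t| <= e.
Proof.
move=> ab e0 fL.
have d0 : 0 < b - a by rewrite subr_gt0.
(* A Lipschitz constant for [f1], which is f rescaled to [0, 1]; the added 1 makes it positive, so
   that [d] can divide by it. *)
pose K := `|L| * (b - a) + 1.
have K0 : 0 < K by rewrite ltr_wpDl// mulr_ge0// ltW.
pose f1 s := f (a + s * (b - a)).
pose d := e / (2 * K).
have dp : 0 < d by rewrite divr_gt0// mulr_gt0.
(* With n + 1 > d^-2 both error terms of [bernstein_lipschitz] are at most K d, and 2 K d = e. *)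
pose n := Num.truncn (d ^- 2).
pose q1 := bernstein n.+1 (fun k => f1 (k%:R / n.+1%:R)).
exists (q1 \Po (((b - a)^-1)%:P * ('X - a%:P))) => t /andP[at_ tb].
pose s := (t - a) / (b - a).
have s01 : 0 <= s <= 1.
  by rewrite divr_ge0 ?subr_ge0 ?(ltW ab)//= ler_pdivrMr// mul1r lerD2r.
have -> : f t = f1 s by rewrite /f1 /s divfK ?gt_eqF// subrKC.
rewrite horner_comp !hornerE mulrC -/s.
have L1 : forall u v, 0 <= u <= 1 -> 0 <= v <= 1 -> `|f1 u - f1 v| <= K * `|u - v|.
  have sc u : 0 <= u <= 1 -> a <= a + u * (b - a) <= b.
    move=> /andP[u0 u1]; have := mulr_ge0 u0 (ltW d0).
    have : 0 <= (1 - u) * (b - a) by rewrite mulr_ge0 ?subr_ge0 // ltW.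
    by move=> h1 h2; apply/andP; split; lra.
  move=> u v /sc u01 /sc v01; apply: le_trans (fL _ _ u01 v01) _.
  rewrite (_ : _ - _ = (u - v) * (b - a)); last by ring.
  rewrite normrM (gtr0_norm d0) /K; set w := `|u - v|.
  have w0 : 0 <= w * (b - a) by rewrite mulr_ge0 ?normr_ge0 ?ltW.
  by have := ler_wpM2r w0 (ler_norm L); have := normr_ge0 (u - v); rewrite -/w; lra.
apply: le_trans (bernstein_lipschitz n dp (ltW K0) L1 s01) _.
have n0 : 0 < n.+1%:R :> R by rewrite ltr0n.
have : (d * n.+1%:R)^-1 <= d.
  rewrite invf_ple ?posrE ?(mulr_gt0 dp n0)//.
  rewrite (_ : d^-1 = d * d ^- 2); last first.
    by field; rewrite gt_eqF.
  by rewrite ler_wpM2l ?(ltW dp)// ltW// truncnS_gt.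
move=> h; apply: le_trans (_ : K * (d + d) <= _); first by rewrite (ler_pM2l K0) lerD2l.
by rewrite /d le_eqVlt; apply/orP; left; apply/eqP; field; rewrite gt_eqF.
Qed.

(** By the mean value theorem. The derivative r c^(r-1) is monotone in c in a direction that depends
    on the sign of r - 1, so the sum of the two endpoint values serves both cases. *)
Lemma powR_lipschitz (a b r : R) : 0 < a ->
  exists L : R, forall s t, a <= s <= b -> a <= t <= b ->
    `|s `^ r - t `^ r| <= L * `|s - t|.
Proof.
move=> a0.
exists (`|r| * (a `^ (r - 1) + b `^ (r - 1))) => s t.
wlog st : s t / s < t.
  move=> W sI tI; have [st|ts|->] := ltgtP s t; first exact: W.
    by rewrite distrC (distrC s); apply: W.
  by rewrite !subrr normr0 mulr0.
move=> /andP[as_ sb] /andP[at_ tb].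
have s0 := lt_le_trans a0 as_.
have [] := @MVT R (fun x => x `^ r) (fun x => r * x `^ (r - 1)) _ _ st.
- move=> x; rewrite in_itv /= => /andP[sx xt].
  by apply: is_derive1_powR; apply: lt_trans sx.
- apply/continuous_in_subspaceT => x /set_mem/=; rewrite in_itv /= => /andP[sx xt].
  apply: differentiable_continuous; apply/derivable1_diffP.
  by apply: (@ex_derive _ _ _ _ _ _ _ (is_derive1_powR _ (lt_le_trans s0 sx))).
move=> c; rewrite in_itv /= => /andP[sc ct].
have c0 := lt_trans s0 sc.
rewrite distrC => ->; rewrite (distrC s) normrM ler_wpM2r// normrM ler_wpM2l//.
rewrite ger0_norm ?powR_ge0//.
have [r1|r1] := leP 0 (r - 1).
  rewrite ler_wpDl ?powR_ge0 // ge0_ler_powR ?nnegrE//; lra.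
rewrite ler_wpDr ?powR_ge0 //.
have -> : r - 1 = - (1 - r) by ring.
rewrite !powRN lef_pV2 ?posrE ?powR_gt0//.
apply: ge0_ler_powR; rewrite ?nnegrE; lra.
Qed.

End Bernstein.

(** * The underlying real Hilbert space *)

Section RealInner.
Context {R : realType} {H : hilbertType R}.
Implicit Types (x y z : H) (t : R).

(** The real part makes H a real inner product space with the same norm, so that order and algebra
    take place in R. *)
Definition ip x y : R := complex.Re (inner x y).
Definition nr x : R := complex.Re `|x|.

Lemma normr_nr x : `|x| = (nr x)%:C.
Proof. by rewrite RRe_real ?normr_real. Qed.

Lemma nr_ge0 x : 0 <= nr x.
Proof. by rewrite -ler0c -normr_nr normr_ge0. Qed.

Lemma ipxx x : ip x x = nr x ^+ 2.
Proof.
rewrite /ip inner_normE normr_nr -rmorphXn /=; by [].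
Qed.

Lemma innerC x y : inner x y = Num.conj (inner y x).
Proof. by have := @hermC _ _ _ _ inner x y; rewrite expr0 mul1r. Qed.

Lemma ipC x y : ip x y = ip y x.
Proof. by rewrite /ip innerC; case: (inner y x). Qed.

Lemma ipDl x y z : ip (x + y) z = ip x z + ip y z.
Proof. by rewrite /ip linearDl raddfD. Qed.

Lemma ipZl t x z : ip (t%:C *: x) z = t * ip x z.
Proof. by rewrite /ip linearZl_LR /=; case: (inner x z) => a b /=; rewrite mul0r subr0. Qed.

Lemma ipNl x z : ip (- x) z = - ip x z.
Proof. by rewrite /ip linearNl raddfN. Qed.

Lemma ipBl x y z : ip (x - y) z = ip x z - ip y z.
Proof. by rewrite ipDl ipNl. Qed.

Lemma ipDr x y z : ip z (x + y) = ip z x + ip z y.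
Proof. by rewrite ipC ipDl !(ipC z). Qed.

Lemma ipZr t x z : ip z (t%:C *: x) = t * ip z x.
Proof. by rewrite ipC ipZl ipC. Qed.

Lemma ipNr x z : ip z (- x) = - ip z x.
Proof. by rewrite ipC ipNl ipC. Qed.

Lemma ipBr x y z : ip z (x - y) = ip z x - ip z y.
Proof. by rewrite ipDr ipNr. Qed.

Lemma ip0l z : ip 0 z = 0.
Proof. by rewrite -(subrr z) ipBl subrr. Qed.

Lemma ip0r z : ip z 0 = 0.
Proof. by rewrite ipC ip0l. Qed.

Definition ipE := (ipDl, ipDr, ipBl, ipBr, ipNl, ipNr, ipZl, ipZr, ip0l, ip0r).

Lemma ip_ge0 x : 0 <= ip x x.
Proof. by rewrite ipxx sqr_ge0. Qed.

Lemma nr_eq0 x : (nr x == 0) = (x == 0).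
Proof. by rewrite -[x == 0]normr_eq0 normr_nr (inj_eq (@complexI R)). Qed.

Lemma ip_eq0 x : ip x x = 0 -> x = 0.
Proof. by rewrite ipxx => /eqP; rewrite sqrf_eq0 nr_eq0 => /eqP. Qed.

Lemma ip_inj x y : (forall z, ip x z = ip y z) -> x = y.
Proof.
move=> xy; apply/eqP; rewrite -subr_eq0; apply/eqP/ip_eq0.
by rewrite ipBl xy subrr.
Qed.

Lemma nrD x y : nr (x + y) <= nr x + nr y.
Proof. by rewrite -lecR rmorphD /= -!normr_nr ler_normD. Qed.

Lemma nrN x : nr (- x) = nr x.
Proof. by rewrite /nr normrN. Qed.

Lemma nrBC x y : nr (x - y) = nr (y - x).
Proof. by rewrite -nrN opprB. Qed.

Lemma nrBD x y z : nr (x - z) <= nr (x - y) + nr (y - z).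
Proof. by rewrite (le_trans _ (nrD _ _))// addrA subrK. Qed.

Lemma nrZ t x : nr (t%:C *: x) = `|t| * nr x.
Proof.
apply: (@complexI R); rewrite rmorphM /= -!normr_nr normrZ; congr (_ * _).
by rewrite normc_def /= expr0n addr0 sqrtr_sqr.
Qed.

Lemma nr0 : nr 0 = 0.
Proof. by apply/eqP; rewrite nr_eq0. Qed.

(** The imaginary part is again a real inner product, so an adjoint identity checked for [ip] lifts
    to [inner] as soon as the operators commute with multiplication by i. *)
Lemma ipi x y : inner x y = ip x y +i* ip x ('i *: y).
Proof.
rewrite /ip linearZr_LR /=; case: (inner x y) => a b /=.
by rewrite mul0r sub0r mulN1r opprK.
Qed.

Lemma ip_inner S T : (forall x y : H, ip (S x) y = ip x (T y)) ->
  (forall a x, T (a *: x) = a *: T x) -> forall x y, inner (S x) y = inner x (T y).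
Proof. by move=> h hT x y; rewrite !ipi !h hT. Qed.

Lemma cauchy_schwarz x y : `|ip x y| <= nr x * nr y.
Proof.
have [->|y0] := eqVneq y 0; first by rewrite ip0r nr0 mulr0 normr0.
rewrite -(@ler_pXn2r _ 2) ?nnegrE ?mulr_ge0 ?nr_ge0 //.
rewrite exprMn -!ipxx real_normK ?num_real//.
have yy : 0 < ip y y by rewrite lt_def ip_ge0 andbT; apply: contra y0 => /eqP /ip_eq0 ->.
have := ip_ge0 ((ip y y)%:C *: x - (ip x y)%:C *: y).
rewrite !ipE (ipC y x) => h.
have {}h: 0 <= ip y y * (ip x x * ip y y - ip x y ^+ 2) by move: h; lra.
by rewrite -subr_ge0 -(pmulr_rge0 _ yy).
Qed.

Lemma ip_le x y : ip x y <= nr x * nr y.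
Proof. exact: le_trans (ler_norm _) (cauchy_schwarz _ _). Qed.

Definition tends (u : nat -> H) (l : H) :=
  forall e : R, 0 < e -> exists N, forall k, (N <= k)%N -> nr (u k - l) <= e.

Lemma complete (u : nat -> H) :
  (forall e : R, 0 < e ->
    exists N, forall k l, (N <= k)%N -> (N <= l)%N -> nr (u k - u l) <= e) ->
  exists l, tends u l.
Proof.
move=> uC.
have cu : cvgn u.
  apply/cauchy_cvgP/cauchy_ballP => e e0.
  have [E [eE E0]] : exists E : R, e = E%:C /\ 0 < E.
    move: e0; rewrite ltcE; case: e => a b /= /andP[/eqP -> a0].
    by exists a.
  have E20 : 0 < E / 2 by rewrite divr_gt0.
  have [N hN] := uC _ E20.
  rewrite near_map2.
  exists ([set k | (N <= k)%N], [set k | (N <= k)%N]).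
    by split; exists N.
  case=> k l [/= kN lN].
  rewrite -ball_normE /ball_ /= eE normr_nr ltcR.
  by rewrite (@le_lt_trans _ _ (E / 2)) ?hN //; lra.
exists (limn u) => e e0.
have e0' : 0 < e%:C :> R[i] by rewrite ltcR.
have [N _ hN] := (cvgrPdistC_le _ _).1 cu _ e0'.
exists N => k kN.
by rewrite -lecR -normr_nr; apply: hN.
Qed.

End RealInner.

(** * Bounded operators and coercive forms *)

Section Bounded.
Context {R : realType} {H : hilbertType R}.
Implicit Types (x y z : H) (S T P : H -> H) (t : R).

Lemma linD T : linear T -> {morph T : x y / x + y}.
Proof. by move=> lT x y; rewrite -[x in LHS]scale1r lT scale1r. Qed.

Lemma lin0 T : linear T -> T 0 = 0.
Proof. by move=> lT; apply: (@addrI _ (T 0)); rewrite -linD // !addr0. Qed.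

Lemma linZ T : linear T -> forall a, {morph T : x / a *: x}.
Proof. by move=> lT a x; rewrite -[a *: x]addr0 lT lin0 // addr0. Qed.

Lemma linN T : linear T -> {morph T : x / - x}.
Proof. by move=> lT x; rewrite -scaleN1r linZ // scaleN1r. Qed.

Lemma linB T : linear T -> {morph T : x y / x - y}.
Proof. by move=> lT x y; rewrite linD // linN. Qed.

Lemma bounded_nr T : bounded_op T ->
  exists2 M : R, 0 < M & forall x, nr (T x) <= M * nr x.
Proof.
case=> _ [M hM]; exists (`|M| + 1) => [|x]; first by rewrite ltr_wpDl.
have := hM x; rewrite !normr_nr -rmorphM lecR => h; apply: le_trans h _.
by rewrite ler_wpM2r ?nr_ge0 // (le_trans (ler_norm _)) // lerDl.
Qed.

Lemma nr_bounded T (M : R) : linear T -> (forall x, nr (T x) <= M * nr x) ->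
  bounded_op T.
Proof.
by move=> lT hM; split=> //; exists M => x; rewrite !normr_nr -rmorphM lecR.
Qed.

Lemma bounded_id : bounded_op (@id H).
Proof. by apply: (@nr_bounded _ 1) => // x; rewrite mul1r. Qed.

Lemma bounded_comp S T : bounded_op S -> bounded_op T -> bounded_op (S \o T).
Proof.
move=> bS bT; have [M M0 hM] := bounded_nr bS; have [N N0 hN] := bounded_nr bT.
apply: (@nr_bounded _ (M * N)) => [a u v /=|x /=]; first by rewrite bT.1 bS.1.
by rewrite (le_trans (hM _)) // -mulrA ler_wpM2l ?hN // ltW.
Qed.

Lemma bounded_iter n T : bounded_op T -> bounded_op (iter n T).
Proof.
move=> bT; elim: n => [|n IH]; first exact: bounded_id.
exact: (bounded_comp bT IH).
Qed.

Lemma bounded_add S T : bounded_op S -> bounded_op T ->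
  bounded_op (fun x => S x + T x).
Proof.
move=> bS bT; have [M M0 hM] := bounded_nr bS; have [N N0 hN] := bounded_nr bT.
apply: (@nr_bounded _ (M + N)) => [a u v /=|x /=].
  by rewrite bT.1 bS.1 scalerDr addrACA.
by rewrite (le_trans (nrD _ _)) // mulrDl lerD.
Qed.

Lemma bounded_scale (a : R[i]) T : bounded_op T -> bounded_op (fun x => a *: T x).
Proof.
move=> [lT [M hM]]; split=> [b u v|]; first by rewrite lT scalerDr !scalerA mulrC.
exists (complex.Re `|a| * M) => x;
  have realM (b d : R) : (b * d)%:C = b%:C * d%:C by rewrite rmorphM.
by rewrite normrZ realM RRe_real ?normr_real // -mulrA ler_wpM2l.
Qed.

Lemma bounded_sub S T : bounded_op S -> bounded_op T ->
  bounded_op (fun x => S x - T x).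
Proof.
move=> bS bT; rewrite (_ : (fun x => _) = fun x => S x + (-1) *: T x).
  exact/bounded_add/bounded_scale.
by apply/funext => x; rewrite scaleN1r.
Qed.

(* Minimisation of the coercive quadratic functional
   [x |-> ip (P x) x - 2 * phi x], whose infimum is attained by completeness. *)
Lemma lax_milgram P (phi : H -> R) (c M K : R) :
  (forall x y, P (x + y) = P x + P y) -> (forall t x, P (t%:C *: x) = t%:C *: P x) ->
  (forall x y, ip (P x) y = ip x (P y)) -> 0 < c ->
  (forall x, c * nr x ^+ 2 <= ip (P x) x) -> (forall x, nr (P x) <= M * nr x) ->
  (forall x y, phi (x + y) = phi x + phi y) ->
  (forall t x, phi (t%:C *: x) = t * phi x) ->
  (forall x, `|phi x| <= K * nr x) ->
  exists z, forall x, ip (P z) x = phi x.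
Proof.
move=> PD PZ Ps c0 Pc PM pD pZ pK.
pose J x := ip (P x) x - 2 * phi x.
have Jlb x : - (K ^+ 2 / c) <= J x.
  rewrite /J; have := Pc x; have := pK x; rewrite ler_norml => /andP[_ h1 h2].
  (* Completing the square: with w = |x|, c w^2 - 2 K w >= - K^2 / c. *)
  have : 0 <= c^-1 * (c * nr x - K) ^+ 2 by rewrite mulr_ge0 ?invr_ge0 ?sqr_ge0 ?ltW.
  rewrite (_ : c^-1 * _ = c * nr x ^+ 2 - 2 * (K * nr x) + K ^+ 2 / c); last first.
    by field; rewrite gt_eqF.
  by lra.
have hinf : has_inf (range J).
  by split; [exists (J 0), 0|exists (- (K ^+ 2 / c)) => _ [x _ <-]].
pose d := inf (range J).
have dJ x : d <= J x by apply: ge_inf; [exact: hinf.2|exists x].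
have /choice[u hu] (k : nat) : exists x, J x < d + k.+1%:R^-1.
  have [_ [x _ <-] h] :=
    @inf_adherent _ (range J) k.+1%:R^-1 (ltac:(by rewrite invr_gt0)) hinf.
  by exists x.
have JD x y t : J (x + t%:C *: y) =
    J x + t ^+ 2 * ip (P y) y + 2 * t * (ip (P x) y - phi y).
  rewrite /J PD PZ pD pZ !ipE (Ps y x) (ipC y (P x)); ring.
(* Approximate first-order condition: along the line u_k + t x the functional is a parabola in t
   that stays above d, and its value at the vertex t = -b/a bounds the square of its slope b. *)
have near k x : (ip (P (u k)) x - phi x) ^+ 2 <= ip (P x) x / k.+1%:R.
  set b := _ - _; set a := ip _ _; set eps := k.+1%:R^-1.
  have a0 : 0 <= a by rewrite (le_trans _ (Pc x)) // mulr_ge0 ?sqr_ge0 ?ltW.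
  have h t : 0 <= eps + t ^+ 2 * a + 2 * t * b.
    by have := dJ (u k + t%:C *: x); rewrite JD -/a -/b; have := hu k; rewrite -/eps; lra.
  have e0 : 0 < eps by rewrite invr_gt0.
  have [a00|] := eqVneq a 0.
    rewrite a00 mul0r.
    have [->|b0] := eqVneq b 0; first by rewrite expr0n.
    (* The parabola has degenerated to a line, and this t gives it the negative value -eps. *)
    have := h (- eps / b); rewrite a00.
    by rewrite (_ : _ + _ = - eps); [lra|field].
  move=> an0; have ap : 0 < a by rewrite lt_def an0.
  have := h (- b / a); rewrite (_ : _ + _ = (a * eps - b ^+ 2) / a); last by field.
  by rewrite pmulr_lge0 ?invr_gt0 // subr_ge0.
have uC k l : c * nr (u k - u l) ^+ 2 <= 2 * (k.+1%:R^-1 + l.+1%:R^-1).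
  apply: le_trans (Pc _) _.
  (* The value at the midpoint of u_k and u_l is the mean of the two values minus a quarter of the
     form at u_k - u_l, and it is at least d. *)
  have := dJ (u l + (2^-1)%:C *: (u k - u l)); rewrite JD.
  have E : J (u k) = J (u l + 1%:C *: (u k - u l)) by rewrite scale1r subrKC.
  move: E; rewrite JD; have := hu k; have := hu l.
  rewrite expr1n (_ : 2^-1 ^+ 2 = 4^-1 :> R); last by field.
  set i := k.+1%:R^-1; set j := l.+1%:R^-1.
  lra.
have [z hz] : exists z, tends u z.
  apply: complete => e e0.
  have p0 : 0 < c * e ^+ 2 / 4 by rewrite divr_gt0 ?mulr_gt0 ?exprn_gt0.
  exists (Num.truncn (c * e ^+ 2 / 4)^-1) => k l kN lN.
  have hk j : (Num.truncn (c * e ^+ 2 / 4)^-1 <= j)%N -> j.+1%:R^-1 <= c * e ^+ 2 / 4.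
    move=> jN; rewrite invf_ple ?posrE //.
    by apply: le_trans (ltW (truncnS_gt _)) _; rewrite ler_nat ltnS.
  have := uC k l; have := hk _ kN; have := hk _ lN => h1 h2 h3.
  rewrite -(@ler_pXn2r _ 2) ?nnegrE ?nr_ge0 ?(ltW e0) //.
  by rewrite -(ler_pM2l c0); move: h1 h2 h3;
    set i := l.+1%:R^-1; set j := k.+1%:R^-1; set w := nr _; nra.
exists z => x; apply/eqP; rewrite -subr_eq0 -sqrf_eq0; apply/eqP.
set B := ip _ _ - _.
have Mx : 0 <= `|M| * nr x by rewrite mulr_ge0 ?nr_ge0.
apply/eqP; rewrite eq_le sqr_ge0 andbT.
apply/ler_addgt0Pl => e e0; rewrite addr0.
have Px0 : 0 <= ip (P x) x by rewrite (le_trans _ (Pc x)) // mulr_ge0 ?sqr_ge0 ?ltW.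
(* The choice makes |u_k - z| <= sqrt r imply <P (u_k - z), x>^2 <= e/4; k is also taken so large
   that [near] yields e/4. Together they give B^2 <= e. *)
pose r := e / (4 * (`|M| * nr x + 1) ^+ 2).
have q0 : 0 < (`|M| * nr x + 1) ^+ 2 by rewrite exprn_gt0 // ltr_wpDl.
have r0 : 0 < r by rewrite /r divr_gt0 // mulr_gt0.
have sr0 : 0 < Num.sqrt r by rewrite sqrtr_gt0.
have [N hN] := hz _ sr0.
pose k := maxn N (Num.truncn (4 * (ip (P x) x + 1) / e)).
have kN := hN k (leq_maxl _ _).
have h1 : `|ip (P (u k - z)) x| <= Num.sqrt r * (`|M| * nr x + 1).
  rewrite Ps (le_trans (cauchy_schwarz _ _)) // ler_pM ?nr_ge0 //.
  rewrite (le_trans (PM _)) // (@le_trans _ _ (`|M| * nr x)) ?lerDl //.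
  by rewrite ler_wpM2r ?nr_ge0 ?ler_norm.
have {}h1 : ip (P (u k - z)) x ^+ 2 <= e / 4.
  rewrite -[_ ^+ 2]real_normK ?num_real //.
  apply: le_trans (_ : (Num.sqrt r * (`|M| * nr x + 1)) ^+ 2 <= _).
    by rewrite ler_pXn2r ?nnegrE // mulr_ge0 ?sqrtr_ge0 // addr_ge0.
  rewrite exprMn sqr_sqrtr ?(ltW r0) // /r le_eqVlt; apply/orP; left.
  by apply/eqP; field; rewrite gt_eqF // ltr_wpDl.
have h2 : ip (P x) x / k.+1%:R <= e / 4.
  rewrite ler_pdivrMr // mulrC -ler_pdivrMr ?divr_gt0 //.
  apply: le_trans (_ : 4 * (ip (P x) x + 1) / e <= _).
    rewrite (_ : ip (P x) x / (e / 4) = 4 * ip (P x) x / e); last by field; rewrite gt_eqF.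
    by rewrite ler_wpM2r ?invr_ge0 ?ltW //; lra.
  by apply: le_trans (ltW (truncnS_gt _)) _; rewrite ler_nat ltnS leq_maxr.
have := near k x.
have -> : ip (P (u k)) x - phi x = B + ip (P (u k - z)) x.
  have -> : P (u k) = P z + P (u k - z) by rewrite -PD subrKC.
  by rewrite /B !ipE; ring.
move: h1 h2; set w := ip (P (u k - z)) x; have := sqr_ge0 (B + 2 * w) => a1 a2 a3 a4.
have {}a4 := le_trans a4 a3.
have aux (p q s : R) : 0 <= (p + 2 * q) ^+ 2 -> q ^+ 2 <= s / 4 ->
  (p + q) ^+ 2 <= s / 4 -> p ^+ 2 <= s by nra.
exact: aux a1 a2 a4.
Qed.

End Bounded.

(** * Adjoints and positive operators *)

Section Adjoint.
Context {R : realType} {H : hilbertType R}.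
Implicit Types (x y z : H) (A S T P Q : H -> H) (t : R).

Lemma ip_inner_eq S T : linear S -> linear T ->
  (forall x y, ip (S x) y = ip x (T y)) -> forall x y, inner (S x) y = inner x (T y).
Proof. by move=> lS lT h; apply: ip_inner => // a x; exact: linZ. Qed.

Lemma inner_inj x y : (forall z, inner z x = inner z y) -> x = y.
Proof. by move=> h; apply: ip_inj => z; rewrite !(ipC _ z) /ip h. Qed.

(** Only the real part of the functional has to be represented, by [lax_milgram] with P the
    identity; replacing x by i x then matches the imaginary parts. *)
Lemma riesz A y : bounded_op A -> exists z, forall x, inner (A x) y = inner x z.
Proof.
move=> bA; have lA := bA.1; have [M M0 hM] := bounded_nr bA.
have [] := @lax_milgram R H id (fun x => ip (A x) y) 1 1 (M * nr y) => //.
- by move=> x; rewrite mul1r ipxx.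
- by move=> x; rewrite mul1r.
- by move=> u v; rewrite linD // ipDl.
- by move=> t u; rewrite linZ // ipZl.
- move=> x; rewrite (le_trans (cauchy_schwarz _ _)) // mulrAC ler_wpM2r ?nr_ge0 //.
move=> z hz; exists z => x; rewrite !ipi (ipC x z) hz; congr (_ +i* _).
have ReJi (w : R[i]) : complex.Re (Num.conj ('i : R[i]) * w) = - complex.Re ('i * w).
  by case: w => a b /=; rewrite !mul0r !sub0r mulN1r mul1r opprK.
have : ip x ('i *: z) = - ip ('i *: x) z.
  by rewrite /ip linearZr_LR linearZl_LR; exact: ReJi.
have : ip (A x) ('i *: y) = - ip ('i *: A x) y.
  by rewrite /ip linearZr_LR linearZl_LR; exact: ReJi.
by move=> -> ->; rewrite -linZ // -hz (ipC _ z).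
Qed.

Lemma adjP A : bounded_op A -> forall x y, inner (A x) y = inner x (adj A y).
Proof.
move=> bA x y; rewrite /adj; case: xgetP => [z _ //|none].
by have [z hz] := riesz y bA; case: (none z).
Qed.

Lemma ip_adj A : bounded_op A -> forall x y, ip (A x) y = ip x (adj A y).
Proof. by move=> bA x y; rewrite /ip adjP. Qed.

Lemma ip_adjl A : bounded_op A -> forall x y, ip (adj A x) y = ip x (A y).
Proof. by move=> bA x y; rewrite ipC -ip_adj // ipC. Qed.

Lemma adj_eq A S : bounded_op A -> linear S ->
  (forall x y, ip (A x) y = ip x (S y)) -> adj A = S.
Proof.
move=> bA lS h; apply/funext => y; apply: inner_inj => x.
by rewrite -adjP // (ip_inner_eq bA.1 lS).
Qed.

Lemma adj_bounded A : bounded_op A -> bounded_op (adj A).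
Proof.
move=> bA; have [M M0 hM] := bounded_nr bA.
apply: (@nr_bounded _ _ _ M) => [a u v|x].
  apply: inner_inj => z.
  by rewrite -adjP // linearDr linearZr_LR linearDr linearZr_LR /= -!adjP.
have [->|n0] := eqVneq (nr (adj A x)) 0; first by rewrite mulr_ge0 ?nr_ge0 ?ltW.
have p0 : 0 < nr (adj A x) by rewrite lt_def n0 nr_ge0.
rewrite -(ler_pM2l p0) -expr2 -ipxx ip_adjl // (le_trans (ip_le _ _)) //.
by rewrite mulrC mulrA ler_wpM2r ?nr_ge0 // mulrC hM.
Qed.

Lemma adj_comp A S : bounded_op A -> bounded_op S -> adj (A \o S) = adj S \o adj A.
Proof.
move=> bA bS; apply: adj_eq; first exact: bounded_comp.
  exact: (bounded_comp (adj_bounded bS) (adj_bounded bA)).1.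
by move=> x y /=; rewrite !ip_adj.
Qed.

Lemma adj_iter n A : bounded_op A -> adj (iter n A) = iter n (adj A).
Proof.
move=> bA; elim: n => [|n IH]; first by apply: adj_eq => //; exact: bounded_id.
have -> : iter n.+1 A = iter n A \o A by apply/funext => x; rewrite iterSr.
by rewrite adj_comp ?IH //; exact: bounded_iter.
Qed.

(** Symmetry for the real form avoids the choice hidden in [adj]; [symop_selfadjoint] identifies the
    two notions. *)
Definition symop T := bounded_op T /\ forall x y, ip (T x) y = ip x (T y).

Lemma symop_selfadjoint T : symop T <-> selfadjoint_op T.
Proof.
split=> -[bT h]; split=> //; first by apply: adj_eq => //; exact: bT.1.
by move=> x y; rewrite ip_adj // h.
Qed.

Lemma symop_inner T x : symop T -> inner (T x) x = (ip (T x) x)%:C.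
Proof.
move=> [bT h]; have := innerC (T x) x; rewrite -(ip_inner_eq bT.1 bT.1 h) /ip.
case: (inner (T x) x) => a b /= [ab]; congr (_ +i* _); lra.
Qed.

Lemma op_leP S T : op_le S T <->
  [/\ symop S, symop T & forall x, ip (S x) x <= ip (T x) x].
Proof.
split=> [[/symop_selfadjoint sS /symop_selfadjoint sT h]|[sS sT h]].
  by split=> // x; have := h x; rewrite !symop_inner // lecR.
by split=> [||x]; rewrite ?symop_inner ?lecR //; exact/symop_selfadjoint.
Qed.

Lemma symop_id : symop (@id H). Proof. by split=> //; exact: bounded_id. Qed.

Lemma symop_iter n T : symop T -> symop (iter n T).
Proof.
move=> [bT h]; split; first exact: bounded_iter.
by elim: n => //= n IH x y; rewrite h IH -iterSr.
Qed.

Lemma symop_conj A T : bounded_op A -> symop T -> symop (adj A \o T \o A).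
Proof.
move=> bA [bT h]; split=> [|x y /=].
  exact: bounded_comp (bounded_comp (adj_bounded bA) bT) bA.
by rewrite ip_adjl // h -ip_adj.
Qed.

Lemma pos_cauchy_schwarz P x y : symop P -> (forall z, 0 <= ip (P z) z) ->
  ip (P x) y ^+ 2 <= ip (P x) x * ip (P y) y.
Proof.
move=> [[lP _] h] p0; set b := ip (P x) y; set a := ip (P y) y; set d := ip (P x) x.
have q t : 0 <= d + t ^+ 2 * a + 2 * t * b.
  have := p0 (x + t%:C *: y); rewrite linD // linZ // !ipE (h y x) (ipC y).
  by rewrite -/a -/b -/d; congr (0 <= _); ring.
have [a0|an0] := eqVneq a 0.
  rewrite a0 mulr0; have [->|b0] := eqVneq b 0; first by rewrite expr0n.
  (* P may be degenerate at y; the parabola is then a line, and this t gives it the value -1. *)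
  have := q (- (d + 1) / (2 * b)); rewrite a0 mulr0 addr0.
  by rewrite (_ : _ + _ = - 1); [lra|field].
have ap : 0 < a by rewrite lt_def an0 p0.
have := q (- b / a); rewrite (_ : _ + _ = (d * a - b ^+ 2) / a); last by field.
by rewrite pmulr_lge0 ?invr_gt0 // subr_ge0.
Qed.

(** Cauchy-Schwarz for the form of P, at x and P x, gives |P x|^4 <= <P x, x> <P (P x), P x> <= <P
    x, x> M |P x|^2. *)
Lemma pos_nr_le P (M : R) x : symop P -> (forall z, 0 <= ip (P z) z) ->
  (forall z, nr (P z) <= M * nr z) -> nr (P x) ^+ 2 <= M * ip (P x) x.
Proof.
move=> sP p0 hM; have [->|n0] := eqVneq (nr (P x)) 0.
  have [/eqP|xn0] := eqVneq (nr x) 0.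
    by rewrite nr_eq0 => /eqP ->; rewrite ip0r mulr0 expr0n.
  rewrite expr0n mulr_ge0 //; have := le_trans (nr_ge0 _) (hM x).
  by rewrite pmulr_lge0 // lt_def xn0 nr_ge0.
have n2 : 0 < nr (P x) ^+ 2 by rewrite exprn_gt0 // lt_def n0 nr_ge0.
rewrite -(ler_pM2l n2); have := pos_cauchy_schwarz x (P x) sP p0.
rewrite ipxx -expr2 => h; apply: le_trans h _.
rewrite [leRHS](_ : _ = ip (P x) x * (M * nr (P x) ^+ 2)); last by ring.
rewrite ler_wpM2l // (le_trans (ip_le _ _)) //.
by rewrite expr2 mulrA ler_wpM2r ?nr_ge0.
Qed.

(** Surjectivity is [lax_milgram] for the functional [ip y]; injectivity and the bound 1/c on the
    inverse come from coercivity. *)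
Lemma coercive_invertible P (c : R) : symop P -> 0 < c ->
  (forall x, c * nr x ^+ 2 <= ip (P x) x) -> invertible_op P.
Proof.
move=> [bP h] c0 hc; have lP := bP.1; have [M M0 hM] := bounded_nr bP.
have /choice[S hS] y : exists z, P z = y.
  have [] := @lax_milgram R H P (ip y) c M (nr y) => //.
  - exact: linD.
  - by move=> t x; rewrite linZ.
  - by move=> u v; rewrite ipDr.
  - by move=> u v; rewrite ipZr.
  - by move=> x; exact: cauchy_schwarz.
  by move=> z hz; exists z; apply: ip_inj.
have injP x y : P x = P y -> x = y.
  move=> xy; apply/eqP; rewrite -subr_eq0 -nr_eq0 -sqrf_eq0 eq_le sqr_ge0 andbT.
  by have := hc (x - y); rewrite linB // xy subrr ip0l pmulr_rle0.
exists S; last by split=> x; rewrite ?hS //; apply: injP; rewrite hS.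
apply: (@nr_bounded _ _ _ c^-1) => [a u v|x].
  by apply: injP; rewrite (linD lP) (linZ lP) !hS.
have [->|n0] := eqVneq (nr (S x)) 0; first by rewrite mulr_ge0 ?nr_ge0 ?invr_ge0 ?ltW.
have p0 : 0 < nr (S x) by rewrite lt_def n0 nr_ge0.
rewrite ler_pdivlMl // -(ler_pM2r p0) -mulrA -expr2 (le_trans (hc _)) // hS.
exact: ip_le.
Qed.

Lemma invertible_below T : invertible_op T ->
  exists2 c : R, 0 < c & forall x, c * nr x <= nr (T x).
Proof.
move=> [S bS [TS _]]; have [M M0 hM] := bounded_nr bS.
exists M^-1; rewrite ?invr_gt0 // => x; rewrite ler_pdivrMl //.
by rewrite -{1}(TS x) hM.
Qed.

(** Invertibility bounds |P x| below by c |x|, and [pos_nr_le] turns this into a lower bound for the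
    form. *)
Lemma pos_invertible_coercive P : symop P -> (forall z, 0 <= ip (P z) z) ->
  invertible_op P -> exists2 c : R, 0 < c & forall x, c * nr x ^+ 2 <= ip (P x) x.
Proof.
move=> sP p0 /invertible_below[c c0 hc]; have [M M0 hM] := bounded_nr sP.1.
exists (c ^+ 2 / M) => [|x]; first by rewrite divr_gt0 ?exprn_gt0.
rewrite mulrAC ler_pdivrMr // [leRHS]mulrC (le_trans _ (pos_nr_le _ sP p0 hM)) //.
by rewrite -exprMn ler_pXn2r ?nnegrE ?nr_ge0 // mulr_ge0 ?nr_ge0 ?ltW.
Qed.

Lemma invertible_comp S T : invertible_op S -> invertible_op T ->
  invertible_op (S \o T).
Proof.
move=> [S' bS [S1 S2]] [T' bT [T1 T2]]; exists (T' \o S'); first exact: bounded_comp.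
by split=> x /=; rewrite ?S1 ?T1 ?T2 ?S2.
Qed.

Lemma invertible_iter n T : invertible_op T -> invertible_op (iter n T).
Proof.
move=> iT; elim: n => [|n IH]; first by exists id => //; exact: bounded_id.
exact: (invertible_comp iT IH).
Qed.

Lemma invertible_scale (a : R[i]) : a != 0 -> invertible_op (fun x : H => a *: x).
Proof.
move=> a0; exists (fun x => a^-1 *: x); first exact/bounded_scale/bounded_id.
by split=> x; rewrite scalerA ?mulVf ?mulfV // scale1r.
Qed.

(** If Q inverts S T, then Q S is a left inverse of T, and commutation makes it a right inverse
    too. *)
Lemma invertible_factor S T : bounded_op S -> linear T ->
  (forall x, S (T x) = T (S x)) -> invertible_op (S \o T) -> invertible_op T.
Proof.
move=> bS lT ST [Q bQ [Q1 Q2]]; exists (Q \o S); first exact: bounded_comp.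
split=> x /=; first by rewrite [LHS]Q1.
rewrite -[LHS]Q1 /= ST.
have -> : S (T (Q (S x))) = S x by exact: Q2.
by rewrite -ST; exact: Q1.
Qed.

End Adjoint.

(** * Polynomials of a self-adjoint operator *)

Section PolynomialCalculus.
Context {R : realType} {H : hilbertType R}.
Implicit Types (x y z : H) (A S T P Q : H -> H) (t : R) (p : {poly R[i]}) (q : {poly R}).

(** Complex coefficients allow a real polynomial to be split into linear factors before it is
    applied to T. *)
Definition chorner p T x : H := \sum_(i < size p) p`_i *: iter i T x.

Lemma chorner_widen n p T x : (size p <= n)%N ->
  chorner p T x = \sum_(i < n) p`_i *: iter i T x.
Proof.
move=> pn; rewrite /chorner (big_ord_widen _ (fun i => p`_i *: iter i T x) pn).
rewrite big_mkcond /=; apply: eq_bigr => i _; case: ltnP => // pi.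
by rewrite nth_default // scale0r.
Qed.

Lemma op_hornerE q T : op_horner q T = chorner (map_poly (real_complex R) q) T.
Proof.
apply/funext => x; rewrite /op_horner /chorner size_map_poly.
by apply: eq_bigr => i _; rewrite coef_map.
Qed.

Lemma chornerD p1 p2 T x : chorner (p1 + p2) T x = chorner p1 T x + chorner p2 T x.
Proof.
pose n := maxn (size p1) (size p2).
rewrite !(@chorner_widen n) ?leq_maxl ?leq_maxr //; last exact: size_polyD.
by rewrite -big_split /=; apply: eq_bigr => i _; rewrite coefD scalerDl.
Qed.

Lemma chornerN p T x : chorner (- p) T x = - chorner p T x.
Proof.
by rewrite /chorner size_polyN -sumrN; apply: eq_bigr => i _; rewrite coefN scaleNr.
Qed.

Lemma chornerC (a : R[i]) T x : chorner a%:P T x = a *: x.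
Proof.
by rewrite (@chorner_widen 1) ?size_polyC_leq1 // big_ord1 coefC.
Qed.

Lemma chornerMX p T x : chorner (p * 'X) T x = chorner p T (T x).
Proof.
rewrite (@chorner_widen (size p).+1); last first.
  by rewrite (leq_trans (size_polyMleq _ _)) // size_polyX addn2.
rewrite big_ord_recl coefMX /= scale0r add0r /chorner; apply: eq_bigr => i _.
by rewrite coefMX /= -iterS iterSr.
Qed.

Lemma chorner_linear p T : linear T -> linear (chorner p T).
Proof.
move=> lT a u v; elim/poly_ind: p u v => [|p c IH] u v.
  by rewrite -[0]/(0%:P) !chornerC !scale0r scaler0 addr0.
by rewrite !chornerD !chornerMX lT IH !chornerC !scalerDr !scalerA mulrC addrACA.
Qed.

Lemma chorner_bounded p T : bounded_op T -> bounded_op (chorner p T).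
Proof.
move=> bT; elim/poly_ind: p => [|p c IH].
  rewrite (_ : chorner 0 T = fun x => 0 *: x); first exact/bounded_scale/bounded_id.
  by apply/funext => x; rewrite -[0]/(0%:P) chornerC.
rewrite (_ : chorner _ T = fun x => (chorner p T \o T) x + c *: x).
  exact: bounded_add (bounded_comp IH bT) (bounded_scale c bounded_id).
by apply/funext => x; rewrite chornerD chornerMX chornerC.
Qed.

Lemma chornerM p1 p2 T x : linear T ->
  chorner (p1 * p2) T x = chorner p1 T (chorner p2 T x).
Proof.
move=> lT; elim/poly_ind: p2 x => [|p c IH] x.
  by rewrite mulr0 -[0]/(0%:P) !chornerC !scale0r lin0 //; exact: chorner_linear.
have lh := chorner_linear p1 lT.
rewrite mulrDr mulrA !chornerD !chornerMX chornerC (linD lh) (linZ lh) IH.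
by rewrite mulrC mul_polyC -[c *: p1]mul_polyC; congr (_ + _);
  elim/poly_ind: p1 {IH lh} x => [|p1 d IH] x;
  rewrite ?mulr0 ?mulrDr ?mulrA ?chornerD ?chornerMX ?IH -?[0]/(0%:P) -?polyCM ?chornerC
    ?scale0r ?scaler0 ?scalerDr ?scalerA.
Qed.

Lemma chorner_intertwine p T S G x : linear G -> (forall y, G (T y) = S (G y)) ->
  G (chorner p T x) = chorner p S (G x).
Proof.
move=> lG GT; elim/poly_ind: p x => [|p c IH] x.
  by rewrite -[0]/(0%:P) !chornerC linZ.
by rewrite !chornerD !chornerMX !chornerC linD // linZ // IH GT.
Qed.

Lemma symop_op_horner q T : symop T -> symop (op_horner q T).
Proof.
move=> sT; have [bT h] := sT; split; first by rewrite op_hornerE; exact: chorner_bounded.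
move=> x y; rewrite /op_horner.
have ip_sum (I : Type) (r : seq I) (F : I -> H) z :
    ip (\sum_(i <- r) F i) z = \sum_(i <- r) ip (F i) z.
  by apply: (big_morph (fun u => ip u z)) => [u v|]; rewrite ?ipDl ?ip0l.
rewrite ip_sum ipC ip_sum; apply: eq_bigr => i _.
by rewrite !ipZl (symop_iter i sT).2 ipC.
Qed.

Lemma chorner_XsubC (l : R[i]) T x : chorner ('X - l%:P) T x = T x - l *: x.
Proof.
rewrite -[X in X - _]mul1r -polyCN chornerD chornerMX chornerC.
by rewrite scale1r chornerC scaleNr.
Qed.

(** For l = u + iv with v nonzero, (T - u + iv) (T - u - iv) = (T - u)^2 + v^2 is coercive, so its
    commuting factors are invertible. For real u outside [a, b], T - u or u - T is coercive. *)
Lemma spectrum_sub T (a b : R) (l : R[i]) : symop T ->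
  (forall x, a * nr x ^+ 2 <= ip (T x) x) ->
  (forall x, ip (T x) x <= b * nr x ^+ 2) ->
  spectrum T l -> exists2 t : R, a <= t <= b & l = t%:C.
Proof.
move=> sT ha hb; case: l => u v ninv; have [bT h] := sT; have lT := bT.1.
have saTr (s : R) : symop (fun x => T x - s%:C *: x).
  split=> [|x y]; first exact: bounded_sub bT (bounded_scale _ bounded_id).
  by rewrite !ipE h.
have v0 : v = 0.
  apply: contrapT => /eqP vn0; apply: ninv.
  pose Q x := T x - u%:C *: x.
  have sQ : symop Q by exact: saTr.
  pose p1 : {poly R[i]} := 'X - (u -i* v)%:P; pose p2 : {poly R[i]} := 'X - (u +i* v)%:P.
  have -> : (fun x => T x - (u +i* v) *: x) = chorner p2 T.
    by apply/funext => x; rewrite chorner_XsubC.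
  apply: (@invertible_factor _ _ (chorner p1 T));
    [exact: chorner_bounded|exact: chorner_linear|..].
    by move=> x; rewrite -!chornerM // mulrC.
  have pE : p1 * p2 = ('X - u%:C%:P) * ('X - u%:C%:P) + ((v ^+ 2)%:C)%:P.
    pose J : R[i] := 0 +i* v.
    have -> : p1 = 'X - (u%:C - J)%:P by congr ('X - _%:P); rewrite /J; simpc.
    have -> : p2 = 'X - (u%:C + J)%:P by congr ('X - _%:P); rewrite /J; simpc.
    have -> : (v ^+ 2)%:C = - J * J by rewrite /J; simpc.
    by rewrite polyCB polyCD polyCM polyCN; ring.
  have QE : chorner p1 T \o chorner p2 T = fun x => Q (Q x) + (v ^+ 2)%:C *: x.
    apply/funext => x /=.
    by rewrite -chornerM // pE chornerD chornerM // !chorner_XsubC chornerC.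
  have v2 : 0 < v ^+ 2 by rewrite exprn_even_gt0.
  rewrite QE; apply: (@coercive_invertible _ _ _ (v ^+ 2)) => //.
    split=> [|x y]; last by rewrite ipDl ipZl ipDr ipZr !sQ.2.
    exact: bounded_add (bounded_comp sQ.1 sQ.1) (bounded_scale _ bounded_id).
  by move=> x; rewrite ipDl ipZl ipxx lerDr sQ.2 ip_ge0.
exists u; last by rewrite v0.
apply: contrapT => /negP; rewrite negb_and -!ltNge => /orP[ua|bu]; apply: ninv.
  rewrite v0; apply: (@coercive_invertible _ _ _ (a - u)); rewrite ?subr_gt0 //.
    exact: saTr.
  by move=> x; rewrite !ipE ipxx mulrBl lerD2r.
have -> : (fun x => T x - (u +i* v) *: x) =
    (fun x : H => (-1) *: x) \o (fun x => u%:C *: x - T x).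
  by apply/funext => x /=; rewrite v0 scaleN1r opprB.
apply: invertible_comp; first by apply: invertible_scale; rewrite oppr_eq0 oner_eq0.
apply: (@coercive_invertible _ _ _ (u - b)); rewrite ?subr_gt0 //.
  split=> [|x y]; last by rewrite !ipE h.
  exact: bounded_sub (bounded_scale _ bounded_id) bT.
by move=> x; rewrite !ipE ipxx mulrBl lerB.
Qed.

(** The witness is the greatest lower bound of the form on unit vectors. If T minus it were
    invertible, it would be coercive by [pos_invertible_coercive], and the bound could be raised. *)
Lemma spectrum_nonempty T x : symop T -> x != 0 ->
  exists2 t : R, spectrum T t%:C & forall y, t * nr y ^+ 2 <= ip (T y) y.
Proof.
move=> sT x0; have [bT h] := sT; have [M M0 hM] := bounded_nr bT.
have nx : 0 < nr x ^+ 2 by rewrite exprn_gt0 // lt_def nr_ge0 nr_eq0 x0.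
pose E := [set a : R | forall y, a * nr y ^+ 2 <= ip (T y) y].
have hE : has_sup E.
  split; [exists (- M)|exists (ip (T x) x / nr x ^+ 2)] => [y|a Ea].
    rewrite mulNr lerNl (le_trans _ (_ : nr (T y) * nr y <= _)) //.
      by rewrite -ipNl (le_trans (ip_le _ _)) // nrN.
    by rewrite expr2 mulrA ler_wpM2r ?nr_ge0.
  by rewrite ler_pdivlMr.
have supE y : sup E * nr y ^+ 2 <= ip (T y) y.
  have [y0|yn0] := eqVneq (nr y) 0.
    by move/eqP: y0; rewrite nr_eq0 => /eqP ->; rewrite nr0 ip0r expr0n mulr0.
  have ny : 0 < nr y ^+ 2 by rewrite exprn_gt0 // lt_def nr_ge0 yn0.
  rewrite -ler_pdivlMr //; apply: ge_sup; first exact: hE.1.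
  by move=> a Ea; rewrite ler_pdivlMr.
exists (sup E) => // inv.
have sP : symop (fun y => T y - (sup E)%:C *: y).
  split=> [|y z]; first exact: bounded_sub bT (bounded_scale _ bounded_id).
  by rewrite !ipE h.
have [y|c c0 hc] := pos_invertible_coercive sP _ inv.
  by rewrite !ipE ipxx subr_ge0.
suff : sup E + c <= sup E by rewrite gerDl leNgt c0.
apply: sup_upper_bound => // y /=.
by have := hc y; rewrite !ipE ipxx lerBrDr mulrDl addrC.
Qed.

Lemma chorner_prod_invertible (rs : seq R[i]) T : linear T ->
  (forall r, r \in rs -> ~ spectrum T r) ->
  invertible_op (chorner (\prod_(r <- rs) ('X - r%:P)) T).
Proof.
move=> lT; elim: rs => [|r rs IH] hr.
  rewrite big_nil -polyC1 (_ : chorner _ T = id); last first.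
    by apply/funext => x; rewrite chornerC scale1r.
  by exists id => //; exact: bounded_id.
rewrite big_cons (_ : chorner _ T =
  chorner ('X - r%:P) T \o chorner (\prod_(r <- rs) ('X - r%:P)) T).
  apply: invertible_comp; last by apply: IH => s srs; apply: hr; rewrite inE srs orbT.
  rewrite (_ : chorner _ T = fun x => T x - r *: x); last first.
    by apply/funext => x; rewrite chorner_XsubC.
  by apply: contrapT; apply: hr; rewrite mem_head.
by apply/funext => x; rewrite /= chornerM.
Qed.

(* If the norm N of [q(T)] exceeded e then [N^2 - q^2] would have no root in the
   spectrum, so [N^2 - q(T)^2] would be positive and invertible, hence coercive,
   against the choice of N. *)
Lemma op_horner_norm q T e : symop T -> 0 <= e ->
  (forall t : R, spectrum T t%:C -> `|q.[t]| <= e) ->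
  forall x, nr (op_horner q T x) <= e * nr x.
Proof.
move=> sT e0 he x; have [->|x0] := eqVneq x 0.
  by rewrite lin0 ?nr0 ?mulr0 //; exact: (symop_op_horner q sT).1.1.
have [bT h] := sT; have lT := bT.1.
set S := op_horner q T; have sS : symop S := symop_op_horner q sT.
have [M M0 hM] := bounded_nr sS.1.
pose E := [set a : R | 0 <= a /\ forall y, nr (S y) ^+ 2 <= a * nr y ^+ 2].
have hE : has_inf E.
  split; last by exists 0 => a [].
  exists (M ^+ 2); split=> [|y]; first exact: sqr_ge0.
  by rewrite -exprMn ler_pXn2r ?nnegrE ?nr_ge0 // mulr_ge0 ?nr_ge0 ?ltW.
(* This N is the square of the operator norm of q(T): it is compared with e^2, and the polynomial
   below is N - q^2. *)
pose N := inf E.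
have N0 : 0 <= N by apply: lb_le_inf; [exact: hE.1|move=> a []].
have hN y : nr (S y) ^+ 2 <= N * nr y ^+ 2.
  have [y0|yn0] := eqVneq (nr y) 0.
    move/eqP: y0; rewrite nr_eq0 => /eqP ->.
    by rewrite lin0 ?nr0 ?expr0n ?mulr0 //; exact: sS.1.1.
  have ny : 0 < nr y ^+ 2 by rewrite exprn_gt0 // lt_def nr_ge0 yn0.
  rewrite -ler_pdivrMr //; apply: lb_le_inf; first exact: hE.1.
  by move=> a [_ ha]; rewrite ler_pdivrMr.
have [Ne|eN] := leP N (e ^+ 2).
  rewrite -(@ler_pXn2r _ 2) ?nnegrE ?nr_ge0 ?mulr_ge0 ?nr_ge0 //.
  by rewrite (le_trans (hN x)) // exprMn ler_wpM2r ?sqr_ge0.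
exfalso.
pose pr : {poly R} := N%:P - q * q.
pose p := map_poly (real_complex R) pr.
have pE (t : R) : p.[t%:C] = (N - q.[t] ^+ 2)%:C.
  by rewrite /p horner_map /pr !hornerE expr2.
have pP t : spectrum T t%:C -> p.[t%:C] != 0.
  move=> st; rewrite pE (inj_eq (@complexI R) _ 0) subr_eq0 gt_eqF //.
  apply: le_lt_trans eN; rewrite -[_ ^+ 2]real_normK ?num_real //.
  by rewrite ler_pXn2r ?nnegrE // he.
have p0 : p != 0.
  by have [t /pP + _] := spectrum_nonempty sT x0; apply: contra => /eqP ->; rewrite horner0.
have [rs rsE] := closed_field_poly_normal p.
(* A root of p in the spectrum would be real by [spectrum_sub], for the crude range [-K, K], and
   [pP] rules that out. *)
have lsp r : r \in rs -> ~ spectrum T r.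
  move=> rr sr; have [K K0 hK] := bounded_nr bT.
  have hK2 y : `|ip (T y) y| <= K * nr y ^+ 2.
    by rewrite (le_trans (cauchy_schwarz _ _)) // expr2 mulrA ler_wpM2r ?nr_ge0.
  have [y|y|t _ rt] := spectrum_sub (a := - K) (b := K) sT _ _ sr.
  - by have := hK2 y; rewrite ler_norml mulNr => /andP[].
  - by have := hK2 y; rewrite ler_norml => /andP[].
  move: sr; rewrite rt => /pP; rewrite -rt; apply/negP; rewrite negbK -/(root p r).
  by rewrite rsE rootZ ?lead_coef_eq0 // root_prod_XsubC.
pose P y := N%:C *: y - S (S y).
have PE : chorner p T = P.
  apply/funext => y.
  by rewrite /p /pr rmorphB rmorphM /= map_polyC
    chornerD chornerC chornerN chornerM // /P /S op_hornerE.
have iP : invertible_op P.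
  rewrite -PE rsE.
  rewrite (_ : chorner _ T = (fun y : H => lead_coef p *: y) \o
     chorner (\prod_(r <- rs) ('X - r%:P)) T); last first.
    by apply/funext => y; rewrite -mul_polyC chornerM // chornerC.
  apply: invertible_comp; last exact: chorner_prod_invertible.
  by apply: invertible_scale; rewrite lead_coef_eq0.
have sP : symop P.
  split=> [|y z]; last by rewrite !ipE !sS.2.
  exact: bounded_sub (bounded_scale _ bounded_id) (bounded_comp sS.1 sS.1).
have PN y : ip (P y) y = N * nr y ^+ 2 - nr (S y) ^+ 2.
  by rewrite !ipE sS.2 !ipxx.
have [y|c c0 hc] := pos_invertible_coercive sP _ iP; first by rewrite PN subr_ge0.
(* The minimum with N keeps N - d nonnegative, as membership in [E] requires. *)
pose d := Num.min c N.
have N_gt0 : 0 < N by apply: le_lt_trans eN; exact: sqr_ge0.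
have d0 : 0 < d by rewrite lt_min c0 N_gt0.
suff : N <= N - d by rewrite lerBrDr gerDl leNgt d0.
apply: ge_inf; first exact: hE.2.
split=> [|y]; first by rewrite subr_ge0 ge_min lexx orbT.
have := hc y; rewrite PN => hcy.
have : d * nr y ^+ 2 <= c * nr y ^+ 2 by rewrite ler_wpM2r ?sqr_ge0 // ge_min lexx.
by rewrite mulrBl; lra.
Qed.

End PolynomialCalculus.

(** * Continuous functional calculus *)

Section Calculus.
Context {R : realType} {H : hilbertType R}.
Implicit Types (x y z : H) (S T G : H -> H) (a b e K t : R) (f g : R -> R) (p q : {poly R}).

Definition num_range a b T :=
  symop T /\ forall x, a * nr x ^+ 2 <= ip (T x) x <= b * nr x ^+ 2.

(** One polynomial must approximate both f and S. Uniformity is asked on an interval containing the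
    numerical range instead of on the spectrum, so functions are estimated on a plain interval;
    [fun_calcE] returns to [fun_calc]. *)
Definition has_calc a b T f S := forall e, 0 < e -> exists q,
  (forall t, a <= t <= b -> `|q.[t] - f t| <= e) /\
  (forall x, nr (op_horner q T x - S x) <= e * nr x).

Lemma nr_small x K : (forall e, 0 < e -> nr x <= e * K) -> x = 0.
Proof.
move=> h; apply/eqP; rewrite -nr_eq0 eq_le nr_ge0 andbT.
apply/ler_addgt0Pr => e e0; rewrite add0r.
have k0 : 0 < `|K| + 1 by rewrite ltr_wpDl.
apply: le_trans (h _ (divr_gt0 e0 k0)) _; rewrite mulrAC ler_pdivrMr //.
by rewrite ler_wpM2l ?(ltW e0) // (le_trans (ler_norm _)) // lerDl.
Qed.

Lemma op_horner_linear q T : linear T -> linear (op_horner q T).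
Proof. by rewrite op_hornerE; exact: chorner_linear. Qed.

Lemma op_hornerD p q T x : op_horner (p + q) T x = op_horner p T x + op_horner q T x.
Proof. by rewrite !op_hornerE rmorphD chornerD. Qed.

Lemma op_hornerB p q T x : op_horner (p - q) T x = op_horner p T x - op_horner q T x.
Proof. by rewrite !op_hornerE rmorphB chornerD chornerN. Qed.

Lemma op_hornerM p q T x : linear T ->
  op_horner (p * q) T x = op_horner p T (op_horner q T x).
Proof. by move=> lT; rewrite !op_hornerE rmorphM chornerM. Qed.

Lemma op_hornerC a T x : op_horner a%:P T x = a%:C *: x.
Proof. by rewrite !op_hornerE map_polyC chornerC. Qed.

Lemma op_hornerX T x : op_horner 'X T x = T x.
Proof. by rewrite op_hornerE map_polyX -[X in chorner X]mul1r
  chornerMX chornerC scale1r. Qed.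

Section FixedOperator.
Variables (a b : R) (T : H -> H) (nT : num_range a b T).
Implicit Types (c d : R).

Let sT : symop T := nT.1.
Let lT : linear T := nT.1.1.1.

Lemma op_horner_norm_range q e : 0 <= e ->
  (forall t, a <= t <= b -> `|q.[t]| <= e) ->
  forall x, nr (op_horner q T x) <= e * nr x.
Proof.
move=> e0 he; apply: op_horner_norm => // t st.
have [x|x|s sab [ts]] := spectrum_sub (a := a) (b := b) sT _ _ st.
- by have /andP[] := nT.2 x.
- by have /andP[] := nT.2 x.
by rewrite ts he.
Qed.

Lemma nrZc (c : R[i]) x : nr (c *: x) = complex.Re `|c| * nr x.
Proof.
have realM (u v : R) : (u * v)%:C = u%:C * v%:C by rewrite rmorphM.
apply: (@complexI R); rewrite realM -!normr_nr normrZ.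
by rewrite RRe_real ?normr_real.
Qed.

Lemma has_calc_linear f S : has_calc a b T f S -> linear S.
Proof.
move=> cS c u v; apply/eqP; rewrite -subr_eq0; apply/eqP.
apply: (@nr_small _ (nr (c *: u + v) + complex.Re `|c| * nr u + nr v)) => e e0.
have [q [_ qS]] := cS _ e0.
apply: le_trans (nrBD _ (op_horner q T (c *: u + v)) _) _.
rewrite nrBC !mulrDr -addrA lerD ?qS // (op_horner_linear q lT).
rewrite opprD addrACA -scalerBr (le_trans (nrD _ _)) // nrZc lerD ?qS //.
rewrite mulrCA ler_wpM2l ?qS // -ler0c RRe_real ?normr_real //.
Qed.

Lemma has_calc_le f S K : 0 <= K -> has_calc a b T f S ->
  (forall t, a <= t <= b -> `|f t| <= K) -> forall x, nr (S x) <= K * nr x.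
Proof.
move=> K0 cS fK x; apply/ler_addgt0Pl => d d0.
have e0 : 0 < d / (2 * nr x + 1).
  by rewrite divr_gt0 // ltr_wpDl // mulr_ge0 ?nr_ge0.
have [q [qf qS]] := cS _ e0; set e := _ / _ in e0 qf qS.
have h : nr (op_horner q T x) <= (K + e) * nr x.
  apply: op_horner_norm_range => [|t tab]; first by rewrite addr_ge0 // ltW.
  rewrite -(subrK (f t) q.[t]) (le_trans (ler_normD _ _)) // addrC.
  by rewrite lerD ?fK ?qf.
have := nrBD (S x) (op_horner q T x) 0; rewrite !subr0 nrBC.
have := qS x; have : e * (2 * nr x + 1) = d.
  by rewrite /e divfK // gt_eqF // ltr_wpDl // mulr_ge0 ?nr_ge0.
have := h; have := nr_ge0 x.
set u := nr (S x); set v := nr (_ - _); set w := nr (op_horner _ _ _).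
by set z := nr x => z0; nra.
Qed.

Lemma has_calc_bounded f S : has_calc a b T f S -> bounded_op S.
Proof.
move=> cS; have [q [_ qS]] := cS 1 ltr01.
have [M M0 hM] := bounded_nr (symop_op_horner q sT).1.
apply: (@nr_bounded _ _ _ (M + 1)) => [|x]; first exact: has_calc_linear cS.
have := nrBD (S x) (op_horner q T x) 0; rewrite !subr0 nrBC => h.
by rewrite (le_trans h) // mulrDl addrC lerD ?qS.
Qed.

Lemma has_calc_ext f g S : (forall t, a <= t <= b -> f t = g t) ->
  has_calc a b T f S -> has_calc a b T g S.
Proof.
move=> fg cS e e0; have [q [qf qS]] := cS _ e0; exists q; split=> // t tab.
by rewrite -fg ?qf.
Qed.

Lemma has_calc_poly q : has_calc a b T (horner q) (op_horner q T).
Proof.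
move=> e e0; exists q; split=> [t _|x].
  by rewrite subrr normr0 ltW.
by rewrite subrr nr0 mulr_ge0 ?nr_ge0 // ltW.
Qed.

Lemma has_calc_add f g S S' : has_calc a b T f S -> has_calc a b T g S' ->
  has_calc a b T (fun t => f t + g t) (fun x => S x + S' x).
Proof.
move=> cf cg e e0; have e20 : 0 < e / 2 by rewrite divr_gt0.
have [p [pf pS]] := cf _ e20; have [q [qg qS]] := cg _ e20.
exists (p + q); split=> [t tab|x].
  rewrite hornerD opprD addrACA (le_trans (ler_normD _ _)) //.
  by rewrite [e]splitr lerD ?pf ?qg.
rewrite op_hornerD opprD addrACA (le_trans (nrD _ _)) //.
by rewrite [e]splitr mulrDl lerD ?pS ?qS.
Qed.

Lemma has_calc_mul f g S S' K : (forall t, a <= t <= b -> `|f t| <= K) ->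
  (forall t, a <= t <= b -> `|g t| <= K) ->
  has_calc a b T f S -> has_calc a b T g S' ->
  has_calc a b T (fun t => f t * g t) (S \o S').
Proof.
move=> fK gK cf cg e e0.
have [M M0 hM] := bounded_nr (has_calc_bounded cg).
(* As d <= 1, the error of p q against f g is at most d (2 |K| + 1), and that of the operators at
   most d (|K| + 1 + M); D covers both. *)
pose D := 2 * `|K| + 1 + M; have D0 : 0 < D.
  by rewrite addr_gt0 // ltr_wpDl // mulr_ge0.
pose d := Num.min 1 (e / D).
have d0 : 0 < d by rewrite lt_min ltr01 divr_gt0.
have d1 : d <= 1 by rewrite ge_min lexx.
have dD : d * D <= e by rewrite -ler_pdivlMr // ge_min lexx orbT.
have [p [pf pS]] := cf _ d0; have [q [qg qS]] := cg _ d0.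
have K' h t : (forall t, a <= t <= b -> `|h t| <= K) -> a <= t <= b -> `|h t| <= `|K|.
  by move=> hK tab; rewrite (le_trans (hK _ tab)) // ler_norm.
have pK t : a <= t <= b -> `|p.[t]| <= `|K| + d.
  move=> tab; rewrite -(subrK (f t) p.[t]) (le_trans (ler_normD _ _)) // addrC.
  by rewrite lerD ?pf ?K'.
have Kd : 0 <= `|K| + d by rewrite addr_ge0 // ltW.
exists (p * q); split=> [t tab|x].
  rewrite hornerM (_ : _ - _ = p.[t] * (q.[t] - g t) + (p.[t] - f t) * g t); last by ring.
  rewrite (le_trans (ler_normD _ _)) // !normrM.
  apply: le_trans (_ : (`|K| + d) * d + d * `|K| <= _).
    by rewrite lerD // ler_pM ?qg ?pf ?pK ?K'.
  by apply: le_trans dD; rewrite /D; nra.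
rewrite op_hornerM //=.
rewrite (le_trans (nrBD _ (op_horner p T (S' x)) _)) //.
rewrite -(linB (op_horner_linear p lT)).
have h1 := op_horner_norm_range Kd pK (op_horner q T x - S' x).
have h2 := pS (S' x).
have h3 : (`|K| + d) * nr (op_horner q T x - S' x) <= (`|K| + d) * (d * nr x).
  by rewrite ler_wpM2l.
have h4 : d * nr (S' x) <= d * (M * nr x) by rewrite ler_wpM2l ?hM // ltW.
apply: le_trans (lerD (le_trans h1 h3) (le_trans h2 h4)) _.
apply: le_trans (_ : d * D * nr x <= _); last by rewrite ler_wpM2r ?nr_ge0.
rewrite !mulrA -!mulrDl ler_wpM2r ?nr_ge0 // /D.
have := normr_ge0 K; nra.
Qed.

Lemma has_calc_poly_comp q f S K : (forall t, a <= t <= b -> `|f t| <= K) ->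
  has_calc a b T f S -> has_calc a b T (fun t => q.[f t]) (op_horner q S).
Proof.
(* A bound on q o f is carried through the induction because [has_calc_mul] asks for bounded
   factors. *)
move=> fK cS; suff [_ //] : (exists L, forall t, a <= t <= b -> `|q.[f t]| <= L) /\
  has_calc a b T (fun t => q.[f t]) (op_horner q S).
elim/poly_ind: q => [|q c [[L qL] cq]].
  split; first by exists 0 => t _; rewrite horner0 normr0.
  rewrite (_ : op_horner 0 S = op_horner 0 T); last first.
    by apply/funext => x; rewrite -[0]/(0%:P) !op_hornerC.
  by apply: has_calc_ext (has_calc_poly 0) => t _; rewrite !horner0.
have mx (u v : R) : u <= Num.max u v /\ v <= Num.max u v.
  by rewrite !le_max !lexx orbT.
split.
  exists (`|L| * `|K| + `|c|) => t tab; rewrite !hornerE.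
  rewrite (le_trans (ler_normD _ _)) // lerD2r normrM ler_pM //.
    exact: le_trans (qL _ tab) (ler_norm _).
  exact: le_trans (fK _ tab) (ler_norm _).
have := has_calc_add (has_calc_mul (K := Num.max L K) _ _ cq cS) (has_calc_poly c%:P).
rewrite (_ : (fun x => _) = op_horner (q * 'X + c%:P) S); last first.
  apply/funext => x /=; rewrite op_hornerD !op_hornerC.
  by rewrite (op_hornerM _ _ _ (has_calc_linear cS)) op_hornerX.
move=> h; apply: has_calc_ext (h _ _) => [t _|t tab|t tab]; first by rewrite !hornerE.
  exact: le_trans (qL _ tab) (mx _ _).1.
exact: le_trans (fK _ tab) (mx _ _).2.
Qed.

(** With m the midpoint of [c, d], |f - m| <= (d - c)/2 bounds the norm of S - m by [has_calc_le],
    and Cauchy-Schwarz turns this into both bounds on the form. Symmetry passes to the limit from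
    polynomials. *)
Lemma has_calc_num_range f S c d : has_calc a b T f S ->
  (forall t, a <= t <= b -> c <= f t <= d) -> c <= d -> num_range c d S.
Proof.
move=> cS fcd cd.
have bS := has_calc_bounded cS.
split.
  split=> // x y; apply/eqP; rewrite -subr_eq0 -normr_eq0 eq_le normr_ge0 andbT.
  apply/ler_addgt0Pl => e e0; rewrite addr0.
  have k0 : 0 < 2 * (nr x * nr y) + 1 by rewrite ltr_wpDl // !mulr_ge0 ?nr_ge0.
  have [q [_ qS]] := cS _ (divr_gt0 e0 k0).
  have -> : ip (S x) y - ip x (S y) = ip x (op_horner q T y - S y) -
      ip (op_horner q T x - S x) y.
    by rewrite ipBr ipBl (symop_op_horner q sT).2; ring.
  rewrite (le_trans (ler_normB _ _)) //.
  have h1 := cauchy_schwarz x (op_horner q T y - S y).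
  have h2 := cauchy_schwarz (op_horner q T x - S x) y.
  have h3 : nr x * nr (op_horner q T y - S y) <= nr x * (e / (2 * (nr x * nr y) + 1) * nr y).
    by rewrite ler_wpM2l ?nr_ge0.
  have h4 : nr (op_horner q T x - S x) * nr y <= e / (2 * (nr x * nr y) + 1) * nr x * nr y.
    by rewrite ler_wpM2r ?nr_ge0.
  apply: le_trans (lerD (le_trans h1 h3) (le_trans h2 h4)) _.
  rewrite (_ : _ + _ = e * (2 * (nr x * nr y)) / (2 * (nr x * nr y) + 1)); last by ring.
  by rewrite ler_pdivrMr // ler_wpM2l ?(ltW e0) // lerDl.
pose m := (c + d) / 2.
have cm := has_calc_add cS (has_calc_poly (- m)%:P).
have r0 : 0 <= (d - c) / 2 by rewrite divr_ge0 ?subr_ge0.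
have hm : forall x, nr (S x + op_horner (- m)%:P T x) <= (d - c) / 2 * nr x.
  apply: has_calc_le cm _ => // t /fcd /andP[h1 h2]; rewrite hornerC ler_norml /m.
  by apply/andP; split; lra.
move=> x; have := hm x; rewrite op_hornerC.
have := cauchy_schwarz (S x + (- m)%:C *: x) x; rewrite ipDl ipZl ipxx => h h'.
have {h'} : nr (S x + (- m)%:C *: x) * nr x <= (d - c) / 2 * nr x ^+ 2.
  by rewrite expr2 mulrA ler_wpM2r ?nr_ge0.
move=> /(le_trans h); rewrite ler_norml /m => /andP[h1 h2].
by apply/andP; split; lra.
Qed.

Lemma has_calc_exists f :
  (forall e, 0 < e -> exists q : {poly R}, forall t, a <= t <= b -> `|q.[t] - f t| <= e) ->
  exists S, has_calc a b T f S.
Proof.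
move=> hf; pose ep (k : nat) : R := k.+1%:R^-1.
have ep0 k : 0 < ep k by rewrite invr_gt0.
have epN e : 0 < e -> exists N, forall k, (N <= k)%N -> ep k <= e.
  move=> e0; exists (Num.truncn e^-1) => k Nk; rewrite /ep invf_ple ?posrE //.
  by rewrite (le_trans (ltW (truncnS_gt _))) // ler_nat ltnS.
have /choice[q hq] k := hf _ (ep0 k).
have qq k l x : nr (op_horner (q k) T x - op_horner (q l) T x) <= (ep k + ep l) * nr x.
  rewrite -op_hornerB; apply: op_horner_norm_range; first by rewrite addr_ge0 ?ltW.
  move=> t tab; rewrite hornerD hornerN.
  rewrite (_ : _ - _ = ((q k).[t] - f t) - ((q l).[t] - f t)); last by ring.
  by rewrite (le_trans (ler_normB _ _)) // lerD ?hq.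
have /choice[S hS] x : exists y, tends (fun k => op_horner (q k) T x) y.
  apply: complete => e e0.
  have k0 : 0 < 2 * nr x + 1 by rewrite ltr_wpDl // mulr_ge0 ?nr_ge0.
  have [N hN] := epN _ (divr_gt0 e0 k0).
  exists N => k l /hN h1 /hN h2; apply: le_trans (qq _ _ _) _.
  apply: le_trans (_ : e / (2 * nr x + 1) * (2 * nr x) <= _).
    by rewrite mulrA ler_wpM2r ?nr_ge0 // mulr_natr mulr2n lerD.
  by rewrite mulrAC ler_pdivrMr // ler_wpM2l ?(ltW e0) // lerDl.
exists S => e e0; have [N hN] := epN (e / 2) (ltac:(by rewrite divr_gt0)).
exists (q N); split=> [t tab|x].
  by rewrite (le_trans (hq _ _ tab)) // (le_trans (hN _ (leqnn _))) // ler_pdivrMr //; lra.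
apply/ler_addgt0Pl => d d0; have [N' hN'] := hS x _ d0.
pose k := maxn N N'.
apply: le_trans (nrBD _ (op_horner (q k) T x) _) _.
rewrite [leRHS]addrC lerD ?hN' ?leq_maxr //.
rewrite (le_trans (qq _ _ _)) // ler_wpM2r ?nr_ge0 //.
by rewrite [e]splitr lerD ?hN // leq_maxl.
Qed.

End FixedOperator.

(** Replacing g by a polynomial q on [c, d] reduces this to [has_calc_poly_comp]. *)
Lemma has_calc_comp a b c d T f g S S' K : num_range a b T -> has_calc a b T f S ->
  num_range c d S -> (forall t, a <= t <= b -> c <= f t <= d) ->
  has_calc c d S g S' -> has_calc a b T (g \o f) S'.
Proof.
move=> nT cf nS fcd cg e e0; have e20 : 0 < e / 2 by rewrite divr_gt0.
have [q [qg qS]] := cg _ e20.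
have fK t : a <= t <= b -> `|f t| <= `|c| + `|d|.
  move=> /fcd /andP[h1 h2]; rewrite ler_norml.
  have := ler_norm d; have := ler_norm (- c); rewrite normrN.
  by have := normr_ge0 c; have := normr_ge0 d; lra.
have [p [pf pS]] := has_calc_poly_comp nT q fK cf e20.
exists p; split=> [t tab|x].
  rewrite -(subrK q.[f t] p.[t]) -addrA (le_trans (ler_normD _ _)) //.
  by rewrite [e]splitr lerD ?pf ?qg ?fcd.
by rewrite (le_trans (nrBD _ (op_horner q S x) _)) // [e]splitr mulrDl lerD.
Qed.

(** G q(T) = q(T') G holds exactly for polynomials. The approximants q of S and q' of S' may differ,
    but both are close to f on the common interval, hence q(T') and q'(T') are close. *)
Lemma has_calc_intertwine a b T T' G f S S' : num_range a b T -> num_range a b T' ->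
  bounded_op G -> (forall x, G (T x) = T' (G x)) ->
  has_calc a b T f S -> has_calc a b T' f S' -> forall x, G (S x) = S' (G x).
Proof.
move=> nT nT' bG GT cS cS' x; apply/eqP; rewrite -subr_eq0; apply/eqP.
have [M M0 hM] := bounded_nr bG; have lG := bG.1.
apply: (@nr_small _ (M * nr x + 3 * nr (G x))) => e e0.
have [q [qf qS]] := cS _ e0; have [q' [qf' qS']] := cS' _ e0.
apply: le_trans (nrBD _ (G (op_horner q T x)) _) _.
rewrite -(linB lG) mulrDr lerD //.
  by rewrite (le_trans (hM _)) // mulrCA ler_wpM2l ?(ltW M0) // nrBC.
rewrite op_hornerE (chorner_intertwine _ _ lG GT) -op_hornerE.
apply: le_trans (nrBD _ (op_horner q' T' (G x)) _) _.
rewrite (_ : e * (3 * _) = (e + e) * nr (G x) + e * nr (G x)); last by ring.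
rewrite lerD ?qS' // -op_hornerB; apply: (op_horner_norm_range nT').
  by rewrite addr_ge0 // ltW.
move=> t tab; rewrite hornerD hornerN.
rewrite (_ : _ - _ = (q.[t] - f t) - (q'.[t] - f t)); last by ring.
by rewrite (le_trans (ler_normB _ _)) // lerD ?qf ?qf'.
Qed.

Lemma cvg_uniform_le (A : set R) (F : nat -> R -> R) f :
  {uniform A, F @ \oo --> f} <->
  forall e, 0 < e -> \forall k \near \oo, forall t, A t -> `|F k t - f t| <= e.
Proof.
split=> [h e e0|h P /uniform_nbhs[E [entE EP]]].
  have : nbhs (f : {uniform` A -> R}) [set g | forall t, A t -> `|g t - f t| <= e].
    apply/uniform_nbhs; exists [set xy | ball xy.1 e xy.2]; split.
      exact: entourage_ball (PosNum e0).
    move=> g hg t /hg; rewrite -ball_normE /= distrC; exact: ltW.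
  by move=> /h.
move: entE; rewrite -entourage_ballE => -[d /= d0 dE].
have d20 : 0 < d / 2 by rewrite divr_gt0.
have := h _ d20; apply: filterS => k hk; apply: EP => t /hk hkt; apply: dE.
by rewrite /= -ball_normE /= distrC (le_lt_trans hkt) //; lra.
Qed.

(** Whatever limit [xget] picks, its polynomials are uniformly close on the spectrum to those of S,
    so [op_horner_norm] makes the two operators equal. The other case, that no limit exists, is
    refuted by S itself. *)
Lemma fun_calcE a b T f S : num_range a b T -> has_calc a b T f S -> fun_calc T f = S.
Proof.
move=> nT cS; rewrite /fun_calc.
have sp t : spectrum T t%:C -> a <= t <= b.
  move=> st; have [x|x|s sab [ts]] := spectrum_sub (a := a) (b := b) nT.1 _ _ st.
  - by have /andP[] := nT.2 x.
  - by have /andP[] := nT.2 x.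
  by rewrite ts.
case: xgetP => [S' _ [q [/cvg_uniform_le qf qS]]|none].
  apply/funext => x; apply/eqP; rewrite -subr_eq0; apply/eqP.
  apply: (@nr_small _ (4 * nr x)) => e e0.
  have [p [pf pS]] := cS _ e0.
  have [k [kf kS]] := filter_ex (filterI (qf _ e0) (qS _ e0)).
  have {kS} kS y : nr (op_horner (q k) T y - S' y) <= e * nr y.
    by have := kS y; rewrite !normr_nr -rmorphM lecR.
  have : nr (op_horner (p - q k) T x) <= (2 * e) * nr x.
    apply: (op_horner_norm nT.1); first by rewrite mulr_ge0 ?ltW.
    move=> t st; rewrite hornerD hornerN.
    rewrite (_ : _ - _ = (p.[t] - f t) - ((q k).[t] - f t)); last by ring.
    by rewrite (le_trans (ler_normB _ _)) // mulr_natl mulr2n lerD ?pf ?kf ?sp.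
  rewrite op_hornerB => h.
  have := nrBD (S' x) (op_horner (q k) T x) (S x).
  have := nrBD (op_horner (q k) T x) (op_horner p T x) (S x).
  rewrite nrBC in h; move: h; rewrite (nrBC (S' x) (op_horner _ _ _)).
  have := kS x; have := pS x.
  set u1 := nr _; set u2 := nr _; set u3 := nr _; set u4 := nr _; set u5 := nr _.
  lra.
exfalso; apply: (none S).
pose ep (k : nat) : R := k.+1%:R^-1.
have ep0 k : 0 < ep k by rewrite invr_gt0.
have epN e : 0 < e -> \forall k \near \oo, ep k <= e.
  move=> e0; exists (Num.truncn e^-1) => // k /= Nk; rewrite /ep invf_ple ?posrE //.
  by rewrite (le_trans (ltW (truncnS_gt _))) // ler_nat ltnS.
have /choice[q hq] k := cS _ (ep0 k).
exists q; split.
  apply/cvg_uniform_le => e e0; apply: filterS (epN _ e0) => k hk t /sp tab.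
  by rewrite (le_trans ((hq k).1 _ tab)).
move=> e e0; apply: filterS (epN _ e0) => k hk x.
rewrite !normr_nr -rmorphM lecR (le_trans ((hq k).2 x)) //.
by rewrite ler_wpM2r ?nr_ge0.
Qed.

End Calculus.

(** * Real powers and the Loewner-Heinz inequality *)

Section Powers.
Context {R : realType} {H : hilbertType R}.
Implicit Types (x y z u v : H) (S T G P Q X Y : H -> H) (a b c r s : R).

(** Here 0 < a keeps powers Lipschitz on [a, b], and a < b is what the rescaling in [poly_approx]
    requires. *)
Definition posdef T := exists a b, [/\ 0 < a, a < b & num_range a b T].

Lemma coercive_posdef T c : symop T -> 0 < c ->
  (forall x, c * nr x ^+ 2 <= ip (T x) x) -> posdef T.
Proof.
move=> sT c0 hc; have [M M0 hM] := bounded_nr sT.1.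
exists c, (M + c); split; [by []|by rewrite ltrDr|split=> // x].
rewrite hc /= (le_trans (ip_le _ _)) // (le_trans (_ : _ <= M * nr x ^+ 2)) //.
  by rewrite expr2 mulrA ler_wpM2r ?nr_ge0.
by rewrite ler_wpM2r ?sqr_ge0 // lerDl ltW.
Qed.

Lemma posdef_sa T : posdef T -> symop T. Proof. by move=> [a [b [_ _ []]]]. Qed.

Lemma posdef_coercive T : posdef T ->
  exists2 c, 0 < c & forall x, c * nr x ^+ 2 <= ip (T x) x.
Proof. by move=> [a [b [a0 _ [_ h]]]]; exists a => // x; have /andP[] := h x. Qed.

Lemma posdef_ge0 T x : posdef T -> 0 <= ip (T x) x.
Proof.
by move=> /posdef_coercive[c c0 h]; rewrite (le_trans _ (h x)) // mulr_ge0 ?sqr_ge0 ?ltW.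
Qed.

Lemma posdef_gt0 T x : posdef T -> x != 0 -> 0 < ip (T x) x.
Proof.
move=> /posdef_coercive[c c0 h] x0; rewrite (lt_le_trans _ (h x)) // mulr_gt0 //.
by rewrite exprn_gt0 // lt_def nr_ge0 nr_eq0 x0.
Qed.

Lemma op_powR_calc a b T r : 0 < a -> a < b -> num_range a b T ->
  has_calc a b T (fun t => t `^ r) (op_powR T r).
Proof.
move=> a0 ab nT; have [L hL] := powR_lipschitz b r a0.
have [S cS] : exists S, has_calc a b T (fun t => t `^ r) S.
  by apply: has_calc_exists => // e e0; exact: poly_approx ab e0 hL.
by rewrite /op_powR (fun_calcE nT cS).
Qed.

Lemma powR_bounds a b r : 0 < a -> exists c d, [/\ 0 < c, c < d &
  forall t, a <= t <= b -> c <= t `^ r <= d].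
Proof.
move=> a0; have [b0|b0] := leP b 0.
  exists 1, 2; split=> // [|t /andP[at_ tb]]; first by rewrite ltr1n.
  by have := lt_le_trans a0 (le_trans at_ tb); rewrite ltNge b0.
have [r0|r0] := leP 0 r.
  (* Adding the other endpoint value makes c < d strict, as [posdef] demands. *)
  exists (a `^ r), (a `^ r + b `^ r); split=> [||t /andP[at_ tb]]; first exact: powR_gt0.
    by rewrite ltrDl powR_gt0.
  have t0 := lt_le_trans a0 at_.
  rewrite ge0_ler_powR ?nnegrE ?(ltW a0) ?(ltW t0) //=.
  by rewrite ler_wpDl ?powR_ge0 // ge0_ler_powR ?nnegrE ?(ltW b0) ?(ltW t0).
exists (b `^ r), (b `^ r + a `^ r); split=> [||t /andP[at_ tb]]; first exact: powR_gt0.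
  by rewrite ltrDl powR_gt0.
have t0 := lt_le_trans a0 at_.
have [r' -> r'0] : exists2 r', r = - r' & 0 <= r'.
  by exists (- r); rewrite ?opprK // oppr_ge0 ltW.
rewrite !powRN; apply/andP; split.
  by rewrite lef_pV2 ?posrE ?powR_gt0 // ge0_ler_powR ?nnegrE ?(ltW b0) ?(ltW t0).
rewrite ler_wpDl ?invr_ge0 ?powR_ge0 // lef_pV2 ?posrE ?powR_gt0 //.
by rewrite ge0_ler_powR ?nnegrE ?(ltW a0) ?(ltW t0).
Qed.

Lemma posdef_pow T r : posdef T -> posdef (op_powR T r).
Proof.
move=> [a [b [a0 ab nT]]]; have [c [d [c0 cd h]]] := powR_bounds b r a0.
by exists c, d; split=> //;
  exact: (has_calc_num_range nT (op_powR_calc r a0 ab nT) h (ltW cd)).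
Qed.

Lemma op_powRD T r s : posdef T -> op_powR T (r + s) = op_powR T r \o op_powR T s.
Proof.
move=> [a [b [a0 ab nT]]].
have [c [d [c0 cd h]]] := powR_bounds b r a0.
have [c' [d' [c0' cd' h']]] := powR_bounds b s a0.
apply: (fun_calcE nT).
have cM := has_calc_mul nT (K := d + d') _ _
  (op_powR_calc r a0 ab nT) (op_powR_calc s a0 ab nT).
apply: has_calc_ext (cM _ _) => [t /andP[at_ _]|t tab|t tab].
- by rewrite powRD // (gt_eqF (lt_le_trans a0 at_)) implybT.
- have /andP[_ h2] := h _ tab; rewrite ger0_norm ?powR_ge0 // ler_wpDr //.
  exact: ltW (lt_trans c0' cd').
- have /andP[_ h2] := h' _ tab; rewrite ger0_norm ?powR_ge0 // ler_wpDl //.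
  exact: ltW (lt_trans c0 cd).
Qed.

Lemma op_powRM T r s : posdef T -> op_powR (op_powR T r) s = op_powR T (r * s).
Proof.
move=> [a [b [a0 ab nT]]].
have [c [d [c0 cd h]]] := powR_bounds b r a0.
have cT := op_powR_calc r a0 ab nT.
have nS := has_calc_num_range nT cT h (ltW cd).
apply/esym/(fun_calcE nT).
apply: has_calc_ext (has_calc_comp 0 nT cT nS h (op_powR_calc s c0 cd nS)) => t tab /=.
by rewrite powRrM.
Qed.

Lemma op_powR1 T : posdef T -> op_powR T 1 = T.
Proof.
move=> [a [b [a0 ab nT]]]; apply: (fun_calcE nT).
have -> : T = op_horner 'X T by apply/funext => x; rewrite op_hornerX.
have h := @has_calc_poly _ _ a b T 'X.
rewrite [X in has_calc _ _ X](_ : op_horner 'X T = T); last first.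
  by apply/funext => x; rewrite op_hornerX.
apply: has_calc_ext h => t /andP[at_ _]; rewrite hornerX powRr1 //.
exact: ltW (lt_le_trans a0 at_).
Qed.

Lemma op_powR0 T : posdef T -> op_powR T 0 = id.
Proof.
move=> [a [b [a0 ab nT]]]; apply: (fun_calcE nT).
rewrite (_ : id = op_horner 1%:P T); last first.
  by apply/funext => x; rewrite op_hornerC scale1r.
by apply: has_calc_ext (@has_calc_poly _ _ a b T 1%:P) => t _; rewrite hornerC powRr0.
Qed.

Lemma op_powR_iter T n : posdef T -> op_powR T n%:R = iter n T.
Proof.
move=> pT; elim: n => [|n IH]; first exact: op_powR0.
by rewrite -natr1 addrC op_powRD // op_powR1 // IH.
Qed.

Lemma iter_op_powR T n r : posdef T -> iter n (op_powR T r) = op_powR T (r * n%:R).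
Proof. by move=> pT; rewrite -op_powR_iter ?op_powRM //; exact: posdef_pow. Qed.

Lemma op_powRK T r x : posdef T -> op_powR T r (op_powR T (- r) x) = x.
Proof.
by move=> pT; have := op_powRD r (- r) pT; rewrite subrr op_powR0 // => /(congr1 (@^~ x)).
Qed.

Lemma op_powR_comm T r s x : posdef T ->
  op_powR T r (op_powR T s x) = op_powR T s (op_powR T r x).
Proof.
move=> pT; have := op_powRD r s pT; rewrite addrC op_powRD // => /(congr1 (@^~ x)) /=.
by move=> ->.
Qed.

Lemma num_range_widen a b c d T : c <= a -> b <= d -> num_range a b T -> num_range c d T.
Proof.
move=> ca bd [sT h]; split=> // x; have /andP[h1 h2] := h x.
rewrite (le_trans _ h1) ?(le_trans h2) // ler_wpM2r ?sqr_ge0 //.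
Qed.

Lemma op_powR_intertwine T T' G r x : posdef T -> posdef T' -> bounded_op G ->
  (forall y, G (T y) = T' (G y)) -> G (op_powR T r x) = op_powR T' r (G x).
Proof.
move=> [a [b [a0 ab nT]]] [a' [b' [a0' ab' nT']]] bG GT.
pose c := Num.min a a'; pose d := Num.max b b'.
have c0 : 0 < c by rewrite lt_min a0.
have cd : c < d by rewrite lt_max gt_min ab.
have nT2 : num_range c d T.
  by apply: num_range_widen nT; rewrite ?ge_min ?le_max lexx.
have nT2' : num_range c d T'.
  by apply: num_range_widen nT'; rewrite ?ge_min ?le_max lexx orbT.
exact: (has_calc_intertwine nT2 nT2' bG GT
  (op_powR_calc r c0 cd nT2) (op_powR_calc r c0 cd nT2')).
Qed.

Lemma posdef_iter n T : posdef T -> posdef (iter n T).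
Proof. by move=> pT; rewrite -op_powR_iter //; exact: posdef_pow. Qed.

(* With [D = Q - P] and s > 0, <(D + s) u, (Q + s + P) u> >= s^2 |u|^2, so the
   spectrum of D contains no negative number. *)
Lemma sqrt_monotone P Q : symop P -> symop Q -> (forall x, 0 <= ip (Q x) x) ->
  (forall x, nr (P x) <= nr (Q x)) -> forall x, ip (P x) x <= ip (Q x) x.
Proof.
move=> sP sQ Q0 PQ x; have [->|x0] := eqVneq x 0; first by rewrite !ip0r.
pose D y := Q y - P y.
have sD : symop D.
  split=> [|y z]; first exact: bounded_sub sQ.1 sP.1.
  by rewrite /D ipBl ipBr sP.2 sQ.2.
have [t st ht] := spectrum_nonempty sD x0.
have [t0|t0] := leP 0 t.
  by rewrite -subr_ge0 -ipBl (le_trans _ (ht x)) // mulr_ge0 ?sqr_ge0.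
exfalso; apply: st.
(* [V] is D + s for s = -t. It is nonnegative because t is a lower bound of D, so [pos_nr_le] can
   turn a lower bound on |V y| into coercivity. *)
pose V y := D y - t%:C *: y.
have sV : symop V.
  split=> [|y z]; first exact: bounded_sub sD.1 (bounded_scale _ bounded_id).
  by rewrite /V ipBl ipBr sD.2 ipZl ipZr.
have V0 y : 0 <= ip (V y) y by rewrite /V ipBl ipZl ipxx subr_ge0.
have [MV MV0 hMV] := bounded_nr sV.1.
have bU : bounded_op (fun y => (Q y + P y) - t%:C *: y).
  exact: bounded_sub (bounded_add sQ.1 sP.1) (bounded_scale _ bounded_id).
have [MU MU0 hMU] := bounded_nr bU.
have below y : t ^+ 2 * nr y <= MU * nr (V y).
  have [->|y0] := eqVneq y 0; first by rewrite nr0 mulr0 mulr_ge0 ?nr_ge0 ?ltW.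
  have ny : 0 < nr y by rewrite lt_def nr_ge0 nr_eq0 y0.
  rewrite -(ler_pM2r ny) -mulrA -expr2.
  apply: le_trans (_ : ip (V y) (Q y + P y - t%:C *: y) <= _).
    have -> : ip (V y) (Q y + P y - t%:C *: y) =
       ip (Q y) (Q y) - ip (P y) (P y) - 2 * t * ip (Q y) y + t ^+ 2 * ip y y.
      rewrite /V /D !(ipBl, ipBr, ipDl, ipDr, ipZl, ipZr) (ipC (P y) (Q y)) (ipC y).
      by rewrite (ipC y (P y)); ring.
    rewrite !ipxx lerDr addr_ge0 //.
      by rewrite subr_ge0 ler_pXn2r ?nnegrE ?nr_ge0.
    by rewrite oppr_ge0 mulr_le0_ge0 // mulr_ge0_le0 // ltW.
  rewrite (le_trans (ip_le _ _)) // mulrC -mulrA (mulrC (nr (V y))) mulrA.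
  by rewrite ler_wpM2r ?nr_ge0.
have t2 : 0 < t ^+ 2 by rewrite exprn_even_gt0 //= lt_eqF.
apply: (@coercive_invertible _ _ _ ((t ^+ 2 / MU) ^+ 2 / MV)) => //.
  by rewrite divr_gt0 // exprn_gt0 // divr_gt0.
move=> y; rewrite mulrAC ler_pdivrMr // [leRHS]mulrC.
rewrite (le_trans _ (pos_nr_le _ sV V0 hMV)) // -exprMn.
have n0 : 0 <= t ^+ 2 / MU * nr y by rewrite mulr_ge0 ?nr_ge0 // ltW // divr_gt0.
rewrite ler_pXn2r ?nnegrE ?nr_ge0 //.
by rewrite mulrAC ler_pdivrMr // [leRHS]mulrC.
Qed.

(** Conjugating by z = Y^(-j/2) reduces the claim to P <= c Y with P = z X^(j+1) z and c^2 = l m. By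
    [sqrt_monotone], |P u| <= c |Y u| suffices. As <P u, v> = <X^j X z u, z v>, Cauchy-Schwarz for
    the form of X^j bounds its square by <X^(j+2) z u, z u> <X^j z v, z v> <= m |Y u|^2 l |v|^2. *)
Lemma interpolation X Y j (l m : R) : posdef X -> posdef Y -> 0 <= l -> 0 <= m ->
  (forall u, ip (iter j X u) u <= l * ip (iter j Y u) u) ->
  (forall u, ip (iter j.+2 X u) u <= m * ip (iter j.+2 Y u) u) ->
  forall u, ip (iter j.+1 X u) u <= Num.sqrt (l * m) * ip (iter j.+1 Y u) u.
Proof.
move=> pX pY l0 m0 hl hm.
pose c := Num.sqrt (l * m).
have sX := posdef_sa pX; have sY := posdef_sa pY.
pose z := op_powR Y (- (j%:R / 2)); pose w := op_powR Y (j%:R / 2).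
have sz : symop z by exact/posdef_sa/posdef_pow.
have sw : symop w by exact/posdef_sa/posdef_pow.
have ww u : w (w u) = iter j Y u.
  by rewrite -op_powR_iter // [in RHS](_ : j%:R = j%:R / 2 + j%:R / 2) ?op_powRD // -splitr.
have wz u : w (z u) = u by exact: op_powRK.
have zw u : z (w u) = u by rewrite /z /w -[X in op_powR Y X u]opprK op_powRK.
have wY u : w (Y u) = Y (w u).
  by have := op_powR_comm (j%:R / 2) 1 u pY; rewrite op_powR1.
have zY u : z (Y u) = Y (z u).
  by have := op_powR_comm (- (j%:R / 2)) 1 u pY; rewrite op_powR1.
pose P := z \o iter j.+1 X \o z; pose Q u := c%:C *: Y u.
have sP : symop P.
  split=> [|u v /=]; last by rewrite !sz.2 (symop_iter j.+1 sX).2 ?sz.2.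
  exact: bounded_comp (bounded_comp sz.1 (bounded_iter _ sX.1)) sz.1.
have sQ : symop Q.
  split=> [|u v]; first exact: bounded_scale sY.1.
  by rewrite /Q ipZl ipZr sY.2.
have c0 : 0 <= c by exact: sqrtr_ge0.
have Q0 u : 0 <= ip (Q u) u by rewrite /Q ipZl mulr_ge0 // posdef_ge0.
have key u v : ip (P u) v ^+ 2 <= l * m * (nr (Y u) ^+ 2 * nr v ^+ 2).
  have -> : ip (P u) v = ip (iter j X (X (z u))) (z v).
    by rewrite /P /= sz.2 -iterSr.
  have pXj := posdef_iter j pX.
  apply: le_trans (pos_cauchy_schwarz _ _ (posdef_sa pXj) (fun y => posdef_ge0 y pXj)) _.
  have h1 : ip (iter j X (X (z u))) (X (z u)) <= m * nr (Y u) ^+ 2.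
    have e2 (V : H -> H) : V (iter j V (V (z u))) = iter j.+2 V (z u).
      by rewrite iterS iterSr.
    rewrite -sX.2 e2 (le_trans (hm _)) // ler_wpM2l // -e2.
    by rewrite sY.2 -ww sw.2 -zY wz -ipxx.
  have h2 : ip (iter j X (z v)) (z v) <= l * nr v ^+ 2.
    by rewrite (le_trans (hl _)) // ler_wpM2l // -ww sw.2 wz ipxx.
  apply: le_trans (ler_pM _ _ h1 h2) _; [exact: posdef_ge0|exact: posdef_ge0|].
  by rewrite le_eqVlt; apply/orP; left; apply/eqP; ring.
have PQ u : nr (P u) <= nr (Q u).
  rewrite /Q nrZ (ger0_norm c0).
  rewrite -(@ler_pXn2r _ 2) ?nnegrE ?nr_ge0 ?mulr_ge0 ?nr_ge0 //.
  rewrite exprMn sqr_sqrtr ?mulr_ge0 //.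
  have [->|n0] := eqVneq (nr (P u)) 0.
    by rewrite expr0n /= mulr_ge0 ?sqr_ge0 // mulr_ge0.
  have n2 : 0 < nr (P u) ^+ 2 by rewrite exprn_gt0 // lt_def n0 nr_ge0.
  by have := key u (P u); rewrite ipxx [X in X <= _]expr2 mulrA ler_pM2r.
move=> u; have := sqrt_monotone sP sQ Q0 PQ (w u).
have E : ip (Y u) (iter j Y u) = ip (iter j.+1 Y u) u by rewrite (sY.2 u) ipC.
by rewrite /P /Q /= sz.2 zw ipZl -wY sw.2 ww E.
Qed.

(** If l n > 1, the sequence rises to a value above 1 somewhere up to n, and log-convexity then
    keeps it rising through k. Products replace ratios, since l may vanish. *)
Lemma log_convex_le1 (l : nat -> R) n k : (forall j, 0 <= l j) -> l 0%N <= 1 ->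
  (forall j, l j.+1 ^+ 2 <= l j * l j.+2) -> (n <= k)%N -> l k <= 1 -> l n <= 1.
Proof.
move=> l0 l1 lc nk lk; rewrite leNgt; apply/negP => ln.
have [i [ni li li1]] : exists i, [/\ (i < n)%N, l i < l i.+1 & 1 < l i.+1].
  elim: n {nk} ln => [|n IH] ln; first by move: ln; rewrite ltNge l1.
  have [ln1|ln1] := leP (l n) 1; last first.
    by have [i [? ? ?]] := IH ln1; exists i; split=> //; exact: leqW.
  by exists n; split=> //; exact: le_lt_trans ln1 ln.
have up j : l (j + i)%N < l (j + i).+1 /\ 1 < l (j + i).+1.
  elim: j => [|j [h1 h2]]; first by [].
  rewrite addSn; suff h : l (j + i).+1 < l (j + i).+2 by split=> //; exact: lt_trans h2 h.
  rewrite ltNge; apply/negP => h.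
  have := lc (j + i)%N; have := l0 (j + i)%N => h3 h4.
  have : l (j + i)%N * l (j + i).+2 <= l (j + i)%N * l (j + i).+1 by rewrite ler_wpM2l.
  move=> /(le_trans h4); rewrite expr2 ler_pM2r; first by rewrite leNgt h1.
  exact: lt_trans h2.
have [] := up (k - i.+1)%N; rewrite -addnS subnK; last exact: leq_trans nk.
by move=> _; rewrite ltNge lk.
Qed.

(** The best constants in X^j <= l_j Y^j are log-convex by [interpolation], and they are at most 1
    for j = 0 and j = k. *)
Lemma iter_monotone X Y n k : posdef X -> posdef Y -> (n <= k)%N ->
  (forall u, ip (iter k X u) u <= ip (iter k Y u) u) ->
  forall u, ip (iter n X u) u <= ip (iter n Y u) u.
Proof.
move=> pX pY nk hk.
pose E j := [set a : R | 0 <= a /\ forall u, ip (iter j X u) u <= a * ip (iter j Y u) u].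
have hE j : has_inf (E j).
  split; last by exists 0 => a [].
  have [c c0 hc] := posdef_coercive (posdef_iter j pY).
  have [M M0 hM] := bounded_nr (posdef_sa (posdef_iter j pX)).1.
  exists (M / c); split=> [|u]; first by rewrite divr_ge0 // ltW.
  apply: le_trans (_ : M * nr u ^+ 2 <= _).
    by rewrite (le_trans (ip_le _ _)) // expr2 mulrA ler_wpM2r ?nr_ge0.
  by rewrite mulrAC -mulrA ler_wpM2l ?(ltW M0) // ler_pdivlMr // mulrC.
pose l j := inf (E j).
have l0 j : 0 <= l j by apply: lb_le_inf; [exact: (hE j).1|move=> a []].
have lP j u : ip (iter j X u) u <= l j * ip (iter j Y u) u.
  have [->|u0] := eqVneq u 0; first by rewrite !ip0r mulr0.
  have Yu := posdef_gt0 (posdef_iter j pY) u0.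
  rewrite -ler_pdivrMr //; apply: lb_le_inf; first exact: (hE j).1.
  by move=> a [_ ha]; rewrite ler_pdivrMr.
have lmin j a : 0 <= a ->
    (forall u, ip (iter j X u) u <= a * ip (iter j Y u) u) -> l j <= a.
  by move=> a0 ha; apply: ge_inf; first exact: (hE j).2.
have ln : l n <= 1.
  apply: (@log_convex_le1 l n k) => //.
  - by apply: lmin => // u; rewrite mul1r.
  - move=> j; rewrite -[leRHS]sqr_sqrtr ?mulr_ge0 //.
    rewrite ler_pXn2r ?nnegrE ?sqrtr_ge0 // lmin ?sqrtr_ge0 //.
    exact: interpolation (lP _) (lP _).
  - by apply: lmin => // u; rewrite mul1r.
move=> u; rewrite (le_trans (lP n u)) // -[leRHS]mul1r ler_wpM2r //.
exact/posdef_ge0/posdef_iter.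
Qed.

(** This is [iter_monotone] for the k-th roots of X and Y. *)
Lemma loewner_heinz X Y n k : posdef X -> posdef Y -> (n <= k)%N -> (0 < k)%N ->
  (forall u, ip (X u) u <= ip (Y u) u) ->
  forall u, ip (op_powR X (n%:R / k%:R) u) u <= ip (op_powR Y (n%:R / k%:R) u) u.
Proof.
move=> pX pY nk k0 XY.
have root T : posdef T -> iter k (op_powR T k%:R^-1) = T /\
    iter n (op_powR T k%:R^-1) = op_powR T (n%:R / k%:R).
  move=> pT; rewrite !iter_op_powR // mulVf ?pnatr_eq0 -?lt0n // op_powR1 //.
  by rewrite mulrC.
have [X1 X2] := root _ pX; have [Y1 Y2] := root _ pY.
rewrite -X2 -Y2; apply: (iter_monotone _ _ nk); [exact: posdef_pow|exact: posdef_pow|].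
by rewrite X1 Y1.
Qed.

End Powers.

(** * A Furuta-type inequality *)

Section Main.
Context {R : realType} {H : hilbertType R}.
Implicit Types (x y z u v : H) (S T G P Q X Y : H -> H) (a b c r s : R).

Lemma adj_invertible G : bounded_op G -> invertible_op G -> invertible_op (adj G).
Proof.
move=> bG [S bS [GS SG]]; exists (adj S); first exact: adj_bounded.
split=> x; apply: ip_inj => y.
  by rewrite !ip_adjl // SG.
by rewrite !ip_adjl // GS.
Qed.

Lemma posdef_conj G E : bounded_op G -> invertible_op G -> posdef E ->
  posdef (adj G \o E \o G).
Proof.
move=> bG /invertible_below[c c0 hc] pE; have [d d0 hd] := posdef_coercive pE.
apply: (@coercive_posdef _ _ _ (d * c ^+ 2)) => [||x].
- exact: symop_conj bG (posdef_sa pE).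
- by rewrite mulr_gt0 ?exprn_gt0.
rewrite /= ip_adjl // (le_trans _ (hd _)) // -mulrA ler_wpM2l ?(ltW d0) //.
by rewrite -exprMn ler_pXn2r ?nnegrE ?nr_ge0 // mulr_ge0 ?nr_ge0 ?ltW.
Qed.

Lemma posdef_id : posdef (@id H).
Proof.
by apply: (@coercive_posdef _ _ _ 1) => // [|x];
  [exact: symop_id|rewrite mul1r ipxx].
Qed.

Lemma posdef_gram G : bounded_op G -> invertible_op G -> posdef (adj G \o G).
Proof. by move=> bG iG; apply: (posdef_conj bG iG posdef_id). Qed.

(** Cauchy-Schwarz for the form of X^(-r) at u = Y^s v and w = X^r v reads <u, v>^2 <= <X^(-r) u, u>
    <v, w>, and the first factor is at most <Y^(-s) u, u> = <u, v>. *)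
Lemma op_powR_antitone_inv X Y r s : posdef X -> posdef Y ->
  (forall u, ip (op_powR X (- r) u) u <= ip (op_powR Y (- s) u) u) ->
  forall u, ip (op_powR Y s u) u <= ip (op_powR X r u) u.
Proof.
move=> pX pY XY v; have [->|v0] := eqVneq v 0; first by rewrite !ip0r.
have pXr := posdef_pow (- r) pX; have pYs := posdef_pow s pY.
have sX := posdef_sa (posdef_pow r pX); have sYs := posdef_sa pYs.
have KX x : op_powR X (- r) (op_powR X r x) = x.
  by have := op_powRK (- r) x pX; rewrite opprK.
have KY x : op_powR Y (- s) (op_powR Y s x) = x.
  by have := op_powRK (- s) x pY; rewrite opprK.
set u := op_powR Y s v; set w := op_powR X r v.
have y0 : 0 < ip u v by exact: posdef_gt0.
have := pos_cauchy_schwarz u w (posdef_sa pXr) (fun z => posdef_ge0 z pXr).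
rewrite (posdef_sa pXr).2 {1 2}/w KX => h.
have h2 : ip (op_powR X (- r) u) u <= ip u v.
  by rewrite (le_trans (XY u)) // /u KY ipC.
rewrite -(ler_pM2l y0) -expr2 (le_trans h) // (ipC v) ler_wpM2r //.
by apply: posdef_ge0; exact: posdef_pow.
Qed.

(* With K = E^(k/2) G, W = K* K = G* E^k G and Y = K K*, one has
   W^s = K* Y^(s-1) K. *)
Lemma furuta_step E G (k m : nat) : posdef E -> bounded_op G -> invertible_op G ->
  (0 < k)%N -> (0 < m)%N ->
  let F j := op_powR (adj G \o iter j E \o G) (m%:R / (m + j)%:R) in
  (forall u, ip (G u) (G u) <= ip (F k u) u) ->
  forall u, ip (F k u) u <= ip (F k.+1 u) u.
Proof.
move=> pE bG iG k0 m0 F hF.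
have mk0 : (m + k)%:R != 0 :> R by rewrite pnatr_eq0 -lt0n addn_gt0 m0.
have k0R : k%:R != 0 :> R by rewrite pnatr_eq0 -lt0n.
pose Eh := op_powR E (k%:R / 2).
have pEh : posdef Eh := posdef_pow _ pE.
have sEh := posdef_sa pEh.
have EhEh u : Eh (Eh u) = iter k E u.
  by rewrite -op_powR_iter // [in RHS](_ : k%:R = k%:R / 2 + k%:R / 2) ?op_powRD // -splitr.
have iEh : invertible_op Eh.
  by have [c c0 hc] := posdef_coercive pEh; exact: coercive_invertible sEh c0 hc.
pose K := Eh \o G.
have bK : bounded_op K := bounded_comp sEh.1 bG.
have iK : invertible_op K := invertible_comp iEh iG.
have aKE : adj K = adj G \o Eh.
  have [bEh aEh] := (symop_selfadjoint Eh).1 sEh.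
  by rewrite /K adj_comp // aEh.
pose W := adj K \o K; pose Y := K \o adj K.
have WE : adj G \o iter k E \o G = W.
  by apply/funext => u; rewrite /W aKE /K /= EhEh.
have pW : posdef W := posdef_gram bK iK.
have baK := adj_bounded bK.
have KK : adj (adj K) = K.
  by apply: adj_eq => // [|x y]; [exact: bK.1|rewrite ip_adjl].
have pY : posdef Y.
  by have := posdef_gram baK (adj_invertible bK iK); rewrite KK.
(* K* Y = K* K K* = W K*, and this intertwining passes to all powers. *)
have KYs r u : adj K (op_powR Y r u) = op_powR W r (adj K u).
  exact: op_powR_intertwine.
pose r := k%:R / (m + k)%:R : R.
have Ws u : op_powR W (m%:R / (m + k)%:R) u = adj K (op_powR Y (- r) (K u)).
  rewrite KYs -[adj K (K u)]/(W u) -[in RHS](op_powR1 pW).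
  have := op_powRD (- r) 1 pW; rewrite op_powR1 // => /(congr1 (@^~ u)) /= <-.
  by congr (op_powR W _ u); rewrite /r; move: mk0; rewrite natrD => ?; field.
(* K is cancelled by evaluating the hypothesis at the preimage of y under K: G maps it to E^(-k/2)
   y, and [Ws] rewrites the other side. *)
have EY : forall u, ip (op_powR E (- k%:R) u) u <= ip (op_powR Y (- r) u) u.
  move=> y; have [K' _ [_ K'K]] := iK; have := hF (K' y).
  rewrite /F WE Ws ip_adjl // K'K; apply: le_trans.
  pose Em := op_powR E (- (k%:R / 2)).
  have -> : G (K' y) = Em y.
    have := K'K y; rewrite /K /= => Ey; rewrite -[in RHS]Ey.
    by have := op_powRK (- (k%:R / 2)) (G (K' y)) pE; rewrite opprK.
  rewrite -(posdef_sa (posdef_pow (- (k%:R / 2)) pE)).2.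
  have := op_powRD (- (k%:R / 2)) (- (k%:R / 2)) pE => /(congr1 (@^~ y)) /= <-.
  by rewrite -opprD -splitr.
have Yr := op_powR_antitone_inv pE pY EY.
have YE u : ip (op_powR Y ((m + k)%:R^-1) u) u <= ip (E u) u.
  (* The exponent is 1/k; [k0] also serves as 1 <= k. *)
  have := loewner_heinz (posdef_pow r pY) (posdef_pow k%:R pE) k0 k0 Yr u.
  rewrite !op_powRM // (_ : k%:R * (1%:R / k%:R) = 1 :> R) ?op_powR1 //; last by field.
  by rewrite (_ : r * _ = (m + k)%:R^-1) // /r; field; rewrite -natrD mk0 k0R.
have WE1 : adj G \o iter k.+1 E \o G = adj K \o E \o K.
  apply/funext => u; rewrite aKE /K /=; congr (adj G _).
  rewrite -EhEh.
  by have := op_powR_comm 1 (k%:R / 2) (Eh (G u)) pE; rewrite op_powR1.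
pose W1 := adj K \o E \o K.
have pW1 : posdef W1 := posdef_conj bK iK pE.
have WW1 u : ip (op_powR W ((m + k).+1%:R / (m + k)%:R) u) u <= ip (W1 u) u.
  rewrite (_ : _ / _ = (m + k)%:R^-1 + 1 :> R); last first.
    by rewrite -natr1; field; rewrite -natrD.
  rewrite op_powRD // op_powR1 //= -[W u]/(adj K (K u)) -KYs !ip_adjl //.
(* The power m/(m+k+1) turns W^((m+k+1)/(m+k)) into W^(m/(m+k)), which is [F k], and [W1] into
   [F k.+1]. *)
move=> u; have := loewner_heinz (posdef_pow ((m + k).+1%:R / (m + k)%:R) pW) pW1
  (n := m) (k := (m + k).+1) _ _ WW1 u.
rewrite op_powRM // /F WE WE1 addnS => h; apply: le_trans (h _ _) => //.
  rewrite (_ : _ * _ = m%:R / (m + k)%:R :> R) //.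
  by rewrite mulrC mulrA divfK ?pnatr_eq0.
by rewrite leqW // leq_addr.
Qed.

(** The hypothesis of [furuta_step] persists because F has only grown. *)
Lemma furuta_chain E G (n k m : nat) : posdef E -> bounded_op G -> invertible_op G ->
  (0 < n)%N -> (0 < m)%N ->
  let F j := op_powR (adj G \o iter j E \o G) (m%:R / (m + j)%:R) in
  (forall u, ip (G u) (G u) <= ip (F n u) u) ->
  forall u, ip (F n u) u <= ip (F (n + k)%N u) u.
Proof.
move=> pE bG iG n0 m0 F hF; elim: k => [|k IH] u; first by rewrite addn0.
rewrite (le_trans (IH u)) // addnS; apply: furuta_step => // [|v].
  by rewrite addn_gt0 n0.
exact: le_trans (hF v) (IH v).
Qed.

End Main.

Local Close Scope complex_scope.
Local Close Scope classical_set_scope.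

Theorem theorem5p7 (R : realType) (H : hilbertType R) (m n : nat)
    (m_gt0 : (0 < m)%N) (n_gt0 : (0 < n)%N) (n_le_m : (n <= m)%N)
    (A : H -> H) (A_bounded : bounded_op A) (A_inv : invertible_op A)
    (A_eq : forall s : nat, s = m \/ s = (n + m)%N ->
       iter s (adj A) \o iter s A = iter s (adj A \o A))
    (A_le : op_le (iter n (adj A) \o iter n A) (iter n (adj A \o A))) :
  forall p i : nat, p = (n + i * m)%N ->
  let L := op_powR (op_abs (iter (p + m) A)) ((2 * m)%:R / (m + p)%:R) in
  let M := op_powR
    (iter m (adj A) \o
     op_powR (op_abs (iter p A)) ((2 * n)%:R / p%:R) \o
     iter m A) (m%:R / (m + n)%:R) in
  op_le M L /\ op_le (iter 2 (op_abs (iter m A))) M.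
Proof.
pose T k := adj (iter k A) \o iter k A.
have bA k : bounded_op (iter k A) by exact: bounded_iter.
have iA k : invertible_op (iter k A) by exact: invertible_iter.
have pT k : posdef (T k) by exact: posdef_gram.
pose B := adj A \o A.
have pB : posdef B := posdef_gram A_bounded A_inv.
have TB s : s = m \/ s = (n + m)%N -> T s = iter s B.
  by move=> /A_eq; rewrite /T adj_iter.
have TnB u : ip (T n u) u <= ip (iter n B u) u.
  by have /op_leP[_ _ h] := A_le; rewrite /T adj_iter.
pose G := iter m A.
have TD k : T (k + m)%N = adj G \o T k \o G.
  have -> : T (k + m)%N = adj (iter k A \o G) \o (iter k A \o G).
    by rewrite /T (_ : iter (k + m) A = iter k A \o G) //;
      apply/funext => u; rewrite /G /= iterD.
  by rewrite (adj_comp (bA k) (bA m)).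
have conjE S u : ip ((adj G \o S \o G) u) u = ip (S (G u)) (G u).
  exact: ip_adjl (bA m) _ _.
have absE k r : op_powR (op_abs (iter k A)) ((2 * r)%R) = op_powR (T k) r.
  by rewrite /op_abs (op_powRM _ _ (pT k)) mulKf ?pnatr_eq0.
have abs2 k : iter 2 (op_abs (iter k A)) = T k.
  by rewrite /op_abs (iter_op_powR _ _ (pT k)) mulVf ?pnatr_eq0 // (op_powR1 (pT k)).
have natn0 k : (0 < k)%N -> k%:R != 0 :> R by move=> k0; rewrite pnatr_eq0 -lt0n.
have m0 := natn0 _ m_gt0; have n0 := natn0 _ n_gt0.
have mn0 : (m + n)%:R != 0 :> R by apply: natn0; rewrite addn_gt0 m_gt0.
pose MM p := op_powR (adj G \o op_powR (T p) (n%:R / p%:R) \o G) (m%:R / (m + n)%:R).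
pose LL p := op_powR (T (p + m)%N) (m%:R / (m + p)%:R).
have pM p : posdef (MM p) by apply/posdef_pow/(posdef_conj (bA m) (iA m))/posdef_pow.
(* Both inequalities at a single p follow from T_n <= T_p^(n/p). Isolating this lets the induction
   on i use them at one p to obtain that hypothesis at p + m. *)
have main p : (n <= p)%N ->
    (forall u, ip (T n u) u <= ip (op_powR (T p) (n%:R / p%:R) u) u) ->
    (forall u, ip (T m u) u <= ip (MM p u) u) /\
    (forall u, ip (MM p u) u <= ip (LL p u) u).
  move=> np hp; have p0 := natn0 _ (leq_trans n_gt0 np).
  have h1 u : ip (T m u) u <= ip (MM p u) u.
    have h v : ip (T (n + m)%N v) v <=
        ip ((adj G \o op_powR (T p) (n%:R / p%:R) \o G) v) v.
      by rewrite TD !conjE; exact: hp.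
    have pC : posdef (adj G \o op_powR (T p) (n%:R / p%:R) \o G).
      by apply/(posdef_conj (bA m) (iA m))/posdef_pow.
    have := loewner_heinz (n := m) (k := (m + n)%N) (pT (n + m)%N) pC _ _ h u.
    rewrite -/(MM p) (TB (n + m)%N) ?(TB m); [|by left|by right].
    rewrite -!op_powR_iter // op_powRM // (_ : _ * _ = m%:R :> R).
      by apply; rewrite ?leq_addr // addn_gt0 m_gt0.
    by rewrite addnC mulrC divfK.
  split=> // u.
  pose E := op_powR (T p) p%:R^-1.
  have pE : posdef E by exact: posdef_pow.
  have Ej j : iter j E = op_powR (T p) (j%:R / p%:R) by rewrite iter_op_powR // mulrC.
  (* E^n = T_p^(n/p) makes the start of the chain [MM p]; E^p = T_p and [TD] make its end [LL p]. *)
  have := @furuta_chain R H E G n (p - n) m pE (bA m) (iA m) n_gt0 m_gt0 _ u.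
  rewrite /= subnKC // !Ej divff // op_powR1 // -TD; apply.
  by move=> v; rewrite -(ip_adjl (bA m)); exact: h1.
move=> p i pi.
have np : (n <= p)%N by rewrite pi leq_addr.
have hp u : ip (T n u) u <= ip (op_powR (T p) (n%:R / p%:R) u) u.
  rewrite {np}pi; elim: i u => [|i IH] u; first by rewrite mul0n addn0 divff // op_powR1.
  have [h1 h2] := main _ (leq_addr _ _) IH.
  set q := (n + i * m)%N in h1 h2 *.
  have -> : (n + i.+1 * m)%N = (q + m)%N by rewrite mulSn addnCA addnC.
  have qm0 : (q + m)%:R != 0 :> R by apply: natn0; rewrite addn_gt0 m_gt0 orbT.
  have h v : ip (T m v) v <= ip (LL q v) v by exact: le_trans (h1 v) (h2 v).
  have pL : posdef (LL q) by exact: posdef_pow.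
  have := loewner_heinz (n := n) (k := m) (pT m) pL n_le_m m_gt0 h u.
  rewrite /LL op_powRM // (TB m); last by left.
  rewrite -op_powR_iter // op_powRM // (_ : m%:R * _ = n%:R :> R); last by field.
  rewrite op_powR_iter // (_ : _ * _ = n%:R / (q + m)%:R :> R).
    by apply: le_trans; exact: TnB.
  by rewrite addnC mulrC mulrA divfK.
have [h1 h2] := main _ np hp.
have -> : op_powR (op_abs (iter (p + m) A)) ((2 * m)%:R / (m + p)%:R) = LL p.
  by rewrite natrM -mulrA absE.
have -> : op_powR (iter m (adj A) \o op_powR (op_abs (iter p A)) ((2 * n)%:R / p%:R) \o
    iter m A) (m%:R / (m + n)%:R) = MM p.
  by rewrite natrM -mulrA absE -adj_iter.
rewrite abs2 /=; split; apply/op_leP; split=> //; apply: posdef_sa => //; exact: posdef_pow.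
Qed.
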